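(* Let $n\ge1$, $N\ge M\ge0$ and $0\le p\le n$ be integers. The number of plane partitions of trapezoidal shape $(2n,2n-2,\dots,2)$ with entries between $0$ and $N$, where the entries on the main diagonal are at least $M$ and exactly $p$ of them have parity different from $N$, is $$\binom np\,\frac{\binom{N-M+n}{n+1}}{\binom{N-M+n+p}{n+1}}\prod_{1\le i\le j\le n}\frac{(N+M+i+j)(N-M+i+j)}{(i+j)^2}\qquad\text{if }N+M\text{ is even},$$ and $$\binom np\,\frac{\binom{N+M+n+1}{n+1}}{\binom{N+M+1+n+p}{n+1}}\prod_{1\le i\le j\le n}\frac{(N+M+1+i+j)(N-M-1+i+j)}{(i+j)^2}\qquad\text{if }N+M\text{ is odd}.$$ In particular, the number of plane partitions of trapezoidal shape $(2n,2n-2,\dots,2)$ with entries between $0$ and $N$ where the entries on the main diagonal are at least $M$ equals $$2^n\prod_{1\le i\le j\le n}\frac{(N+M+i+j)(N-M-1+i+j)}{(i+j)^2}.$$ (For $p=0$ the quotient of binomial coefficients is read as $1$, also when $N=M$.)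
   Context: The trapezoidal shape $(2n,2n-2,\dots,2)$ is an array of cells with $n$ rows, each row indented by one cell to the right with respect to the previous row, and with $2n-2i+2$ cells in row $i$. A plane partition of this shape is a filling of its cells with nonnegative integers ($0$ allowed) such that entries along rows (left to right) and columns (top to bottom) are weakly decreasing. The entries on the main diagonal are the first entries of the rows. *)

(* Defs.v *)
From HB Require Import structures.
From mathcomp Require Import all_boot all_order all_algebra.

Set Implicit Arguments.
Unset Strict Implicit.
Unset Printing Implicit Defensive.

Import Order.TTheory GRing.Theory Num.Theory.

(* Indices are 0-based: row i (0 <= i < n) starts in column i and has
   2 * n - 2 * i cells, i.e. it occupies the columns i <= j < 2 * n - i. *)
Definition in_trapezoid (n : nat) (c : 'I_n * 'I_(2 * n)) : bool :=
  (c.1 <= c.2 < 2 * n - c.1)%N.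

Definition cell (n : nat) := {c : 'I_n * 'I_(2 * n) | in_trapezoid c}.

Definition crow (n : nat) (c : cell n) : nat := (val c).1.
Definition ccol (n : nat) (c : cell n) : nat := (val c).2.

Definition on_diagonal (n : nat) (c : cell n) : bool := crow c == ccol c.

Definition filling (n N : nat) := {ffun cell n -> 'I_N.+1}.

Definition plane_partition (n N : nat) (f : filling n N) : bool :=
  [forall c : cell n, forall d : cell n,
    ((crow c == crow d) && (ccol c <= ccol d)%N ==> (f d <= f c)%N)
    && ((ccol c == ccol d) && (crow c <= crow d)%N ==> (f d <= f c)%N)].

Definition diagonal_at_least (n N M : nat) (f : filling n N) : bool :=
  [forall c : cell n, on_diagonal c ==> (M <= f c)%N].

Definition diagonal_parity_defect (n N : nat) (f : filling n N) : nat :=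
  #|[set c : cell n | on_diagonal c && (odd (f c) != odd N)]|.

Definition trapezoidal_pps (n N M : nat) : {set filling n N} :=
  [set f | plane_partition f && diagonal_at_least M f].

Definition trapezoidal_pps_parity (n N M p : nat) : {set filling n N} :=
  [set f in trapezoidal_pps n N M | diagonal_parity_defect f == p].

(* 'C(a, k) / 'C(a + p, k), read as 1 for p = 0 even when 'C(a, k) = 0
   (division by 0 in rat would give 0). *)
Definition binom_quotient (a p k : nat) : rat :=
  if p == 0%N then 1%R else ('C(a, k)%:R / 'C(a + p, k)%:R)%R.

(* Main.v *)
Require Import Defs.
From mathcomp Require Import all_boot all_order all_algebra.
From mathcomp Require Import perm zify ring.

(** A plane partition of trapezoidal shape is determined by its diagonals.
    Reading rows from the bottom, the main diagonal is an increasing sequence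
    $\lambda_0\le\dots\le\lambda_{n-1}$, consecutive diagonals interlace, and
    removing two of them leaves a trapezoid with one row less: the plane
    partitions are symplectic patterns.  A sum of determinants over interlacing
    sequences is a determinant of sums ([det_row_sums], [det_row_diff]), and for
    binomial entries these sums telescope.  Hence the number of plane partitions
    with main diagonal $\lambda$ is a binomial determinant
    ([card_plane_partitions_diag]), equal to $D(l)/D(1,\dots,n)$ with
    $l_i=\lambda_i+i+1$ and $D(l)=\prod_i l_i\prod_{i<j}(l_j^2-l_i^2)$
    ([sp_det_prod]), the dimension of a representation of Sp(2n).

    It remains to sum $D$ over all $\lambda$ with parts between $M$ and $N$, with
    a weight $t$ for every part of the wrong parity.  The sum is evaluated for
    the numerators $\det(x_j^{l_i}-x_j^{-l_i})$ of the symplectic characters.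
    Such a numerator is a signed sum of alternants $\det(x_j^{l_i})$ over all
    inversions $x_j\to x_j^{-1}$.  The key is that the weighted sum of alternants
    over $0\le\lambda_i\le c$, divided by the Vandermonde determinant, is
    invariant under inversions up to an explicit factor ([normalized_sum_flip]).
    Indeed, branching to one variable less writes it as a sum over sequences
    $\mu$, in which the remaining variable enters through a product of
    independent sums over the intervals $[\mu_{i-1},\mu_i]$; reversing all the
    intervals changes this product by a telescoping product ([interval_prod_rev]).
    Consequently the sum of the numerators is a factor independent of $M$ times a
    numerator for a rectangle ([sp_sum_factor]).  The rectangular numerator may
    have a zero row, and then the sum vanishes ([sp_sum_vanish]); for a range
    that is symmetric about 0, up to one unit, this leaves only sequences with
    parts among the top two values ([sp_sum_balanced_even], [sp_sum_balanced_odd]), which determines the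
    factor.

    For $x_j=q^{j+1}$ the numerators are products, with leading term $2^nD(l)$ at
    $q=1$, so the identities hold for $D$ as well ([sp_prod_sum_even],
    [sp_prod_sum_odd]).  Comparing coefficients of $t^p$, the number of plane
    partitions becomes a product of two values of $D$: one at consecutive
    integers, and one at $n+1$ consecutive integers with the $p$-th omitted
    ([sp_prod_delete]).  The sum over all $p$ is a terminating case of Kummer's
    summation ([sum_bin_inv_rising]). *)

Set Implicit Arguments.
Unset Strict Implicit.
Unset Printing Implicit Defensive.

Import Order.TTheory GRing.Theory Num.Theory.
Local Open Scope ring_scope.

(** * Determinants *)

(** By distributivity in every row: a determinant summed over independently
    varying row indices is again a determinant. *)
Lemma det_row_sums (R : comRingType) (I : finType) (n : nat)
    (P : 'I_n -> pred I) (phi : 'I_n -> I -> 'I_n -> R) :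
  \det (\matrix_(i, j) \sum_(k | P i k) phi i k j) =
  \sum_(f : {ffun 'I_n -> I} | [forall i, P i (f i)])
    \det (\matrix_(i, j) phi i (f i) j).
Proof.
rewrite /determinant exchange_big /=; apply: eq_bigr => s _.
rewrite -big_distrr /=; congr (_ * _).
transitivity (\prod_i \sum_(k | P i k) phi i k (s i)).
  by apply: eq_bigr => i _; rewrite mxE.
rewrite (bigA_distr_big_dep P (fun i k => phi i k (s i))).
apply: eq_big => [f|f _]; first by apply/familyP/forallP.
by apply: eq_bigr => i _; rewrite mxE.
Qed.

(** [prev_ord i] and [next_ord i] are the two neighbours of the gap [i]
    between consecutive indices of a sequence of length [n.+1]. *)
Definition prev_ord n (i : 'I_n) : 'I_n.+1 := lift ord_max i.
Definition next_ord n (i : 'I_n) : 'I_n.+1 := lift ord0 i.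

Lemma prev_ordE n (i : 'I_n) : prev_ord i = i :> nat.
Proof. exact: lift_max. Qed.

Lemma next_ordE n (i : 'I_n) : next_ord i = i.+1 :> nat.
Proof. exact: lift0. Qed.

(** Subtracting from every row the row above it clears the column of ones
    except in row 0, and the expansion along that column leaves the
    determinant of the differences. This is how interlacing sequences enter: a
    difference [g (next_ord i) - g (prev_ord i)] is a sum over the gap between
    two neighbours. *)
Lemma det_row_diff (R : comRingType) (n : nat) (g : 'I_n.+1 -> 'I_n -> R) :
  \det (\matrix_(i < n.+1, j < n.+1) oapp (g i) 1 (unlift ord0 j)) =
  \det (\matrix_(i < n, j < n) (g (next_ord i) j - g (prev_ord i) j)).
Proof.
set A := (X in \det X = _).
(* [U] encodes the row operations. *)
pose U : 'M[R]_n.+1 := \matrix_(i, k) ((i == k)%:R - (i == k.+1 :> nat)%:R).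
have detU : \det U = 1.
  rewrite det_trig ?big1 // => [i _|]; first by rewrite mxE eqxx; case: eqP => [|_]; [lia|rewrite subr0].
  apply/is_trig_mxP => i j lij; rewrite mxE.
  have -> : (i == j) = false by apply: ltn_eqF.
  have -> : (i == j.+1 :> nat) = false by lia.
  by rewrite subrr.
have UA0 j : (U *m A) ord0 j = A ord0 j.
  rewrite mxE (bigD1 ord0) //= mxE /= subr0 mul1r big1 ?addr0 // => k nk.
  by rewrite mxE eq_sym (negPf nk) subrr mul0r.
have UA1 i j : (U *m A) (next_ord i) j = A (next_ord i) j - A (prev_ord i) j.
  have ne : prev_ord i != next_ord i.
    by apply/eqP => /(congr1 val); rewrite /= /bump /= leqNgt ltn_ord /=; lia.
  rewrite mxE (bigD1 (next_ord i)) //= (bigD1 (prev_ord i)) //= big1 => [|k /andP[k1 k2]].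
    rewrite !mxE eqxx [next_ord i == _]eq_sym (negPf ne) /= /bump /= [(n <= i)%N]leqNgt ltn_ord /= !add0n add1n eqxx.
    have -> : (i.+1 == i.+2) = false by lia.
    by rewrite addr0 subr0 mul1r sub0r mulN1r.
  rewrite mxE eq_sym (negPf k1) /= /bump /= add1n.
  suff -> : (i.+1 == k.+1) = false by rewrite subrr mul0r.
  apply: contraNF k2 => /eqP e; apply/eqP/val_inj.
  by rewrite /= /bump leqNgt ltn_ord /=; lia.
rewrite -[LHS]mul1r -{1}detU -det_mulmx (expand_det_col _ ord0) big_ord_recl big1 ?addr0 => [|i _].
  rewrite UA0 mxE unlift_none /= mul1r /cofactor expr0 mul1r; congr (\det _).
  by apply/matrixP => i j; rewrite [LHS]mxE [LHS]mxE UA1 !mxE liftK.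
by rewrite UA1 !mxE unlift_none /= subrr mul0r.
Qed.

(** The variant with a fictitious zero row in front, for interlacing sequences
    of equal length. *)
Lemma det_row_diff0 (R : comRingType) (n : nat) (g : 'I_n -> 'I_n -> R) :
  \det (\matrix_(i < n, j < n)
     (g i j - oapp (g^~ j) 0 (unlift ord0 (prev_ord i)))) =
  \det (\matrix_(i, j) g i j).
Proof.
pose h (i : 'I_n.+1) (j : 'I_n) := oapp (g^~ j) 0 (unlift ord0 i).
transitivity (\det (\matrix_(i < n, j < n) (h (next_ord i) j - h (prev_ord i) j))).
  by congr (\det _); apply/matrixP => i j; rewrite !mxE /h liftK.
rewrite -det_row_diff (expand_det_row _ ord0) big_ord_recl big1 ?addr0 => [|j _].
  rewrite mxE unlift_none mul1r /cofactor expr0 mul1r; congr (\det _).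
  by apply/matrixP => i j; rewrite !mxE /h !liftK.
by rewrite mxE /h liftK /= unlift_none mul0r.
Qed.

(** The matrix of the values is the transposed Vandermonde matrix times a
    unitriangular matrix of coefficients. *)
Lemma det_monic_polys (R : comRingType) (n : nat) (p : 'I_n -> {poly R})
    (y : 'I_n -> R) :
  (forall j, p j \is monic /\ size (p j) = j.+1) ->
  \det (\matrix_(i, j) (p j).[y i]) =
  \prod_(i < n) \prod_(j < n | (i < j)%N) (y j - y i).
Proof.
move=> hp; pose C : 'M[R]_n := \matrix_(j, k) (p j)`_k.
have -> : \matrix_(i, j) (p j).[y i] = (C *m Vandermonde n (\row_j y j))^T.
  apply/matrixP => i j; rewrite !mxE.
  have [_ sz] := hp j.
  rewrite (@horner_coef_wide _ n); last by rewrite sz.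
  by apply: eq_bigr => k _; rewrite !mxE.
rewrite det_tr det_mulmx det_Vandermonde det_trig.
  rewrite big1 ?mul1r => [|i _].
    by do 2!(apply: eq_bigr => ? _); rewrite !mxE.
  by rewrite mxE; have [/monicP + sz] := hp i; rewrite lead_coefE sz.
apply/is_trig_mxP => i j lij; rewrite mxE nth_default //.
by have [_ ->] := hp i.
Qed.

Lemma det_monomials (R : comRingType) (n : nat) (y : 'I_n -> R) :
  \det (\matrix_(i, j) y j ^+ i) =
  \prod_(i < n) \prod_(j < n | (i < j)%N) (y j - y i).
Proof.
rewrite -det_tr -(@det_monic_polys _ _ (fun j => 'X^j)).
  by congr (\det _); apply/matrixP => i j; rewrite !mxE hornerXn.
by move=> j; rewrite monicXn size_polyXn.
Qed.

(** * Interlacing sums of binomial determinants *)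

Lemma big_ord_between (R : Type) (idx : R) (op : Monoid.com_law idx)
    (N a b : nat) (F : nat -> R) : (b <= N)%N ->
  \big[op/idx]_(k < N.+1 | (a <= k <= b)%N) F k =
  \big[op/idx]_(a <= k < b.+1) F k.
Proof.
move=> bN; rewrite (big_nat_widen _ _ N.+1) // (big_nat_widenl _ 0) // big_mkord.
by apply: eq_bigl => k; rewrite ltnS /= andbC.
Qed.

Lemma sum_between_diff (R : zmodType) (N a b : nat) (F G : nat -> R) :
  (a <= b.+1)%N -> (b <= N)%N -> (forall k, F k = G k.+1 - G k) ->
  \sum_(k < N.+1 | (a <= k <= b)%N) F k = G b.+1 - G a.
Proof.
move=> ab bN FG; rewrite big_ord_between // -telescope_sumr //.
by apply: eq_bigr => k _; rewrite FG.
Qed.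

(** The number of symplectic patterns with top row [lam], given with
    increasing parts; it is the dimension of the representation of Sp(2n) with
    this highest weight. The determinant has entries $\binom{l_i+j}{2j+1}$
    with $l_i=\lambda_i+i+1$, which are odd polynomials in $l_i$ of degree
    $2j+1$. *)
Definition sp_det n (lam : 'I_n -> nat) : rat :=
  \det (\matrix_(i, j) 'C(lam i + i + 1 + j, 2 * j + 1)%:R).

(** The intermediate count after one more diagonal; its entries are
    polynomials in $k_i(k_i-1)$, where $k_i=\kappa_i+i+1$. *)
Definition odd_sp_det n (kap : 'I_n -> nat) : rat :=
  \det (\matrix_(i, j) 'C(kap i + i + j, 2 * j)%:R).

Lemma natr_binS m k : 'C(m, k)%:R = 'C(m.+1, k.+1)%:R - 'C(m, k.+1)%:R :> rat.
Proof. by rewrite binS natrD addrAC subrr add0r. Qed.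

(** By the hockey-stick identity the sum of an entry over a gap is a
    difference of two entries of [odd_sp_det], whose column 0 consists of
    ones, so [det_row_diff] applies. *)
Lemma sum_sp_det (N n : nat) (kap : 'I_n.+1 -> nat) :
  (forall i : 'I_n, kap (prev_ord i) <= kap (next_ord i))%N ->
  (forall i, kap i <= N)%N ->
  \sum_(mu : {ffun 'I_n -> 'I_N.+1} |
      [forall i, kap (prev_ord i) <= mu i <= kap (next_ord i)]%N)
    sp_det (fun i => mu i) = odd_sp_det kap.
Proof.
move=> mono le_N; rewrite /sp_det.
rewrite -(det_row_sums
  (fun i (k : 'I_N.+1) => kap (prev_ord i) <= k <= kap (next_ord i))%N
  (fun i (k : 'I_N.+1) j => 'C(k + i + 1 + j, 2 * j + 1)%:R)).
pose g (i : 'I_n.+1) (j : 'I_n) : rat := 'C(kap i + i + j.+1, 2 * j.+1)%:R.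
transitivity (\det (\matrix_(i < n, j < n) (g (next_ord i) j - g (prev_ord i) j))).
  congr (\det _); apply/matrixP => i j; rewrite !mxE.
  rewrite (@sum_between_diff _ N _ _ (fun k => 'C(k + i + 1 + j, 2 * j + 1)%:R)
    (fun k => 'C(k + i + 1 + j, 2 * j + 2)%:R)) //.
  - rewrite /g lift_max /= /bump /= add1n; congr ('C(_, _)%:R - 'C(_, _)%:R); lia.
  - exact: leqW.
  - by move=> k; rewrite natr_binS !addnS !addn0.
rewrite -det_row_diff; congr (\det _); apply/matrixP => i j; rewrite !mxE.
by case: unliftP => [j'|] ->; rewrite /= ?bin0.
Qed.

(** The same telescoping, with lower end 0 for the first gap, where the
    boundary term is a vanishing binomial coefficient. *)
Lemma sum_odd_sp_det (N n : nat) (lam : 'I_n -> nat) :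
  (forall i j : 'I_n, i <= j -> lam i <= lam j)%N -> (forall i, lam i <= N)%N ->
  \sum_(kap : {ffun 'I_n -> 'I_N.+1} |
      [forall i, oapp lam 0%N (unlift ord0 (prev_ord i)) <= kap i <= lam i]%N)
    odd_sp_det (fun i => kap i) = sp_det lam.
Proof.
move=> mono le_N; rewrite /odd_sp_det.
rewrite -(det_row_sums
  (fun i (k : 'I_N.+1) =>
     oapp lam 0 (unlift ord0 (prev_ord i)) <= k <= lam i)%N
  (fun i (k : 'I_N.+1) j => 'C(k + i + j, 2 * j)%:R)).
rewrite /sp_det -[RHS]det_row_diff0.
congr (\det _); apply/matrixP => i j; rewrite !mxE.
rewrite (@sum_between_diff _ N _ _ (fun k => 'C(k + i + j, 2 * j)%:R)
  (fun k => 'C(k + i + j, 2 * j + 1)%:R)) //; first last.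
- by move=> k; rewrite natr_binS !addnS !addn0 !addSn.
- apply: leqW; case: unliftP => [k e|//] /=; apply: mono.
  by move/(congr1 val): e; rewrite [X in X = _]lift_max /= /bump /= => ->.
congr (_ - _); first by congr 'C(_, _)%:R; lia.
case: unliftP => [k|] /(congr1 val); rewrite [X in X = _]lift_max /= /bump /= => e.
  by congr 'C(_, _)%:R; lia.
by rewrite bin_small //; lia.
Qed.

Lemma sp_det0 (lam : 'I_0 -> nat) : sp_det lam = 1.
Proof. exact: det_mx00. Qed.

(** * Plane partitions with a given main diagonal *)

Definition mono_fun n (f : 'I_n -> nat) : bool :=
  [forall i : 'I_n, forall j : 'I_n, (i <= j)%N ==> (f i <= f j)%N].

Lemma mono_funP n (f : 'I_n -> nat) :
  reflect (forall i j : 'I_n, i <= j -> f i <= f j)%N (mono_fun f).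
Proof.
apply: (iffP forallP) => [h i j ij|h i]; first by move/forallP/(_ j)/implyP: (h i); apply.
by apply/forallP => j; apply/implyP; apply: h.
Qed.

Lemma mono_fun_adjP n (f : 'I_n.+1 -> nat) :
  reflect (forall i : 'I_n, f (prev_ord i) <= f (next_ord i))%N (mono_fun f).
Proof.
apply: (iffP (mono_funP f)) => [h i|h i j].
  by apply: h; rewrite lift_max /= /bump /=; lia.
case: j => j /= jn; elim: j jn => [|j IHj] jn ij.
  by rewrite (_ : i = Ordinal jn) //; apply: val_inj => /=; lia.
case: (ltngtP i j.+1) ij => // [ij _|ij _]; last first.
  by rewrite (_ : i = Ordinal jn) //; apply: val_inj.
apply: leq_trans (IHj (ltnW jn) _) _ => //.
have e1 : prev_ord (Ordinal (jn : j < n)%N) = Ordinal (ltnW jn).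
  by apply: ord_inj; rewrite prev_ordE.
have e2 : next_ord (Ordinal (jn : j < n)%N) = Ordinal jn by apply: val_inj.
by rewrite -e1 -e2; apply: h.
Qed.

Section Fillings.
Variables (n N : nat).
Implicit Types (f g : filling n N) (c d : cell n).

Lemma cell_bounds c : (crow c <= ccol c < 2 * n - crow c)%N.
Proof. by case: c => -[i j]. Qed.

Lemma cell_inj c d : crow c = crow d -> ccol c = ccol d -> c = d.
Proof.
case: c d => [[i j] hc] [[i' j'] hd]; rewrite /crow /ccol /= => e1 e2.
by apply: val_inj; congr pair; apply: val_inj.
Qed.

Lemma cell_exists i k : (2 * i + k < 2 * n)%N ->
  exists c, crow c = i /\ ccol c = (i + k)%N.
Proof.
move=> h; have hi : (i < n)%N by lia.
have hk : (i + k < 2 * n)%N by lia.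
have hc : in_trapezoid (Ordinal hi, Ordinal hk) by rewrite /in_trapezoid /=; lia.
by exists (Sub (Ordinal hi, Ordinal hk) hc : cell n).
Qed.

(** The entry in row [i] of the [k]-th diagonal, extended by 0 outside the
    shape. With this extension the conditions on neighbouring cells hold
    across the border, so that they can be required for all indices. *)
Definition entry f (i k : nat) : nat :=
  if [pick c | (crow c == i) && (ccol c == (i + k)%N)] is Some c then f c else 0%N.

Lemma entryE f i k c : crow c = i -> ccol c = (i + k)%N -> entry f i k = f c.
Proof.
move=> ci ck; rewrite /entry; case: pickP => [d /andP[/eqP di /eqP dk]|/(_ c)].
  by rewrite (@cell_inj c d) // ?di ?dk.
by rewrite ci ck !eqxx.
Qed.

Lemma entry_cell f c : entry f (crow c) (ccol c - crow c) = f c.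
Proof. by apply: entryE => //; have := cell_bounds c; lia. Qed.

Lemma entry_out f i k : (2 * n <= 2 * i + k)%N -> entry f i k = 0%N.
Proof.
move=> h; rewrite /entry; case: pickP => // c /andP[/eqP ci /eqP ck].
by have := cell_bounds c; lia.
Qed.

Lemma entry_le f i k : (entry f i k <= N)%N.
Proof. by rewrite /entry; case: pickP => // c _; rewrite -ltnS. Qed.

Lemma entry_inj f g : (forall i k, entry f i k = entry g i k) -> f = g.
Proof. by move=> h; apply/ffunP => c; apply: ord_inj; rewrite -!entry_cell. Qed.

Definition fill (G : nat -> nat -> nat) : filling n N :=
  [ffun c => inord (G (crow c) (ccol c - crow c)%N)].

Lemma entry_fill G i k :
  (forall i k, G i k <= N)%N -> (2 * i + k < 2 * n)%N ->
  entry (fill G) i k = G i k.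
Proof.
move=> GN /cell_exists[c [ci ck]]; rewrite (entryE _ ci ck) ffunE inordK ?ltnS //.
by rewrite ci ck addKn.
Qed.

(** Monotonicity along rows and columns reduces to neighbouring cells: in the
    coordinates of [entry] the right neighbour of (i, k) is (i, k+1), and the
    cell below (i, k+1) is (i+1, k). *)
Lemma plane_partitionP f :
  reflect (forall i k, entry f i k.+1 <= entry f i k /\
                       entry f i.+1 k <= entry f i k.+1)%N
          (plane_partition f).
Proof.
apply: (iffP forallP) => [h i k|h c].
  split.
    case: (ltnP (2 * i + k.+1) (2 * n)) => s; last by rewrite [X in (X <= _)%N]entry_out.
    have [d [di dk]] := cell_exists s.
    have [|c [ci ck]] := @cell_exists i k; first by lia.
    rewrite (entryE _ ci ck) (entryE _ di dk).
    have /forallP/(_ d)/andP[/implyP + _] := h c; apply.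
    by rewrite ci di ck dk eqxx leq_add2l /=.
  case: (ltnP (2 * i.+1 + k) (2 * n)) => s; last by rewrite [X in (X <= _)%N]entry_out.
  have [d [di dk]] := cell_exists s.
  have [|c [ci ck]] := @cell_exists i k.+1; first by lia.
  rewrite (entryE _ ci ck) (entryE _ di dk).
  have /forallP/(_ d)/andP[_ /implyP +] := h c; apply.
  by rewrite ci di ck dk addnS addSn eqxx /=.
have mk i k m : (entry f i (k + m) <= entry f i k)%N.
  elim: m => [|m IHm]; first by rewrite addn0.
  by rewrite addnS; apply: leq_trans IHm; have [] := h i (k + m)%N.
have mi i k m : (entry f (i + m) k <= entry f i (k + m))%N.
  elim: m k => [|m IHm] k; first by rewrite !addn0.
  by rewrite !addnS -addSn; apply: leq_trans (IHm k.+1); have [] := h (i + m)%N k.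
apply/forallP => d; apply/andP; split; apply/implyP => /andP[/eqP e le_cd].
  rewrite -!entry_cell -e.
  have := mk (crow c) (ccol c - crow c)%N (ccol d - ccol c)%N.
  by rewrite (_ : _ + _ = ccol d - crow c)%N //; have := cell_bounds c; lia.
rewrite -!entry_cell -e.
have := mi (crow c) (ccol c - crow d)%N (crow d - crow c)%N.
rewrite subnKC // (_ : _ + _ = ccol c - crow c)%N //.
by have := cell_bounds d; lia.
Qed.

(** The main diagonal read from the bottom row upwards, so that it increases.
    *)
Definition diag_fun f : {ffun 'I_n -> 'I_N.+1} :=
  [ffun a : 'I_n => inord (entry f (n - a.+1) 0)].

Lemma diag_funE f a : diag_fun f a = entry f (n - a.+1) 0 :> nat.
Proof. by rewrite ffunE inordK // ltnS entry_le. Qed.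

End Fillings.

Section Peeling.
Variables (n N : nat).

Definition pad (lam : 'I_n.+1 -> nat) (i : nat) : nat :=
  if (i <= n)%N then lam (inord (n - i)) else 0%N.

(** Removing the first two cells of every row of the trapezoid leaves the
    trapezoid with one row less, two columns further to the right; [glue] puts
    two diagonals back, and [second_diag] and [peel] undo it. *)
Definition glue_entry (lam kap : {ffun 'I_n.+1 -> 'I_N.+1}) (g : filling n N)
    (i k : nat) : nat :=
  match k with
  | 0 => pad (fun a => lam a) i
  | 1 => pad (fun a => kap a) i
  | k'.+2 => entry g i k'
  end.

Definition glue lam kap g : filling n.+1 N := fill n.+1 N (glue_entry lam kap g).

Lemma pad_le (lam : {ffun 'I_n.+1 -> 'I_N.+1}) i : (pad (fun a => lam a) i <= N)%N.
Proof. by rewrite /pad; case: ifP => // _; rewrite -ltnS. Qed.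

Lemma entry_glue lam kap g i k : entry (glue lam kap g) i k = glue_entry lam kap g i k.
Proof.
case: (ltnP (2 * i + k) (2 * n.+1)) => h.
  by rewrite entry_fill // => i' [|[|k']] /=; rewrite ?pad_le ?entry_le.
rewrite entry_out //; case: k h => [|[|k]] /= h; last by rewrite entry_out //; lia.
  by rewrite /pad ifN //; lia.
by rewrite /pad ifN //; lia.
Qed.

Definition second_diag (f : filling n.+1 N) : {ffun 'I_n.+1 -> 'I_N.+1} :=
  [ffun a : 'I_n.+1 => inord (entry f (n - a) 1)].

Definition peel (f : filling n.+1 N) : filling n N :=
  fill n N (fun i k => entry f i k.+2).

Lemma entry_peel f i k : entry (peel f) i k = entry f i k.+2.
Proof.
case: (ltnP (2 * i + k) (2 * n)) => h; last by rewrite !entry_out //; lia.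
by rewrite entry_fill // => i' k'; apply: entry_le.
Qed.

Lemma pad_ord (lam : 'I_n.+1 -> nat) (a : 'I_n.+1) : pad lam (n - a) = lam a.
Proof. by rewrite /pad leq_subr subKn ?inord_val // -ltnS. Qed.

Lemma diag_glue lam kap g : diag_fun (glue lam kap g) = lam.
Proof.
apply/ffunP => a; apply: ord_inj; rewrite diag_funE entry_glue /= subSS.
by rewrite (pad_ord (fun a => lam a)).
Qed.

Lemma second_diag_glue lam kap g : second_diag (glue lam kap g) = kap.
Proof.
apply/ffunP => a; rewrite ffunE entry_glue /=.
by rewrite (pad_ord (fun a => kap a)) inord_val.
Qed.

Lemma peel_glue lam kap g : peel (glue lam kap g) = g.
Proof. by apply: entry_inj => i k; rewrite entry_peel entry_glue. Qed.

Lemma glue_peel f : glue (diag_fun f) (second_diag f) (peel f) = f.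
Proof.
apply: entry_inj => i k; rewrite entry_glue.
case: k => [|[|k]] /=; last exact: entry_peel.
  rewrite /pad; case: (leqP i n) => h; last by rewrite entry_out //; lia.
  by rewrite diag_funE inordK ?subSS ?subKn //; lia.
rewrite /pad; case: (leqP i n) => h; last by rewrite entry_out //; lia.
rewrite ffunE [inord (n - i) : nat]inordK; last by lia.
by rewrite inordK ?subKn // ltnS entry_le.
Qed.

(** The condition that [kap] can be the second diagonal next to the main
    diagonal [lam]: $\lambda_{i-1}\le\kappa_i\le\lambda_i$ with
    $\lambda_{-1}=0$. *)
Definition between_diag (lam kap : 'I_n.+1 -> nat) : bool :=
  [forall i, oapp lam 0 (unlift ord0 (prev_ord i)) <= kap i <= lam i]%N.

Definition between_next (kap : 'I_n.+1 -> nat) (mu : 'I_n -> nat) : bool :=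
  [forall i, kap (prev_ord i) <= mu i <= kap (next_ord i)]%N.

Lemma plane_partition_glue lam kap g :
  plane_partition (glue lam kap g) =
  [&& between_diag (fun a => lam a) (fun a => kap a),
      between_next (fun a => kap a) (fun a => diag_fun g a) & plane_partition g].
Proof.
apply/plane_partitionP/and3P => [h|[/forallP h1 /forallP h2 /plane_partitionP h3] i k].
  split.
  - apply/forallP => a.
    have := h (n - a)%N 0%N; rewrite !entry_glue /=.
    rewrite (pad_ord (fun a => kap a)) (pad_ord (fun a => lam a)).
    case=> -> _; rewrite andbT; case: unliftP => [b|//] e.
    have := h (n - a)%N 0%N; rewrite !entry_glue /= (pad_ord (fun a => kap a)).
    have ab : (b.+1 = a)%N.
      by move/(congr1 (@nat_of_ord _)): e; rewrite [X in X = _]prev_ordE /= /bump /=.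
    rewrite (_ : (n - a).+1 = n - b)%N ?(pad_ord (fun a => lam a)); first by case.
    by move: (ltn_ord a); lia.
  - apply/forallP => a; rewrite diag_funE.
    have := h (n - a.+1)%N 1%N; rewrite !entry_glue /=.
    rewrite -(pad_ord (fun a => kap a)) -(pad_ord (fun a => kap a)) prev_ordE /= /bump add1n.
    rewrite (_ : (n - a.+1).+1 = n - a)%N; last by move: (ltn_ord a); lia.
    by case=> -> ->.
  - apply/plane_partitionP => i k.
    by have := h i k.+2; rewrite !entry_glue.
rewrite !entry_glue; case: k => [|[|k]] /=; last exact: h3.
  split.
    rewrite /pad; case: (leqP i n) => // ni.
    by have /andP[] := h1 (inord (n - i)).
  rewrite {1}/pad; case: (ltnP i n) => // ni; rewrite /pad (ltnW ni).
  have /andP[+ _] := h1 (inord (n - i)); apply: leq_trans.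
  rewrite (_ : prev_ord _ = lift ord0 (inord (n - i.+1))) ?liftK //.
  apply: ord_inj; rewrite prev_ordE /= /bump /= !inordK //; lia.
case: (ltnP i n) => ni; last first.
  by rewrite !(@entry_out n) ?/pad ?ltnNge ?ni //=; lia.
have lt : (n - i.+1 < n)%N by lia.
have := h2 (Ordinal lt); rewrite diag_funE /= (_ : (n - (n - i.+1).+1)%N = i); last by lia.
rewrite /pad ni (ltnW ni).
rewrite (_ : prev_ord _ = inord (n - i.+1)); last by apply: ord_inj; rewrite prev_ordE inordK //=; lia.
rewrite (_ : next_ord _ = inord (n - i)); first by case/andP.
by apply: ord_inj; rewrite /= /bump /= inordK //; lia.
Qed.

End Peeling.

(** Induction on the number of rows: the first two diagonals are peeled off,
    and the two interlacing conditions are summed by [sum_sp_det] and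
    [sum_odd_sp_det]. *)
Lemma card_plane_partitions_diag (n N : nat) (lam : {ffun 'I_n -> 'I_N.+1}) :
  mono_fun (fun a => lam a) ->
  #|[set f : filling n N | plane_partition f && (diag_fun f == lam)]|%:R =
  sp_det (fun a => lam a).
Proof.
elim: n lam => [|n IHn] lam mono_lam.
  rewrite sp_det0 (_ : [set _ | _] = setT).
    rewrite cardsT card_ffun (_ : #|{: cell 0}| = 0%N) ?expn0 //.
    by apply: eq_card0 => -[[[]]].
  apply/setP => f; rewrite !inE.
  have -> : plane_partition f by apply/forallP => -[[[]]].
  by apply/eqP/ffunP => -[].
rewrite -sum1_card (reindex_onto
  (fun p : {ffun 'I_n.+1 -> 'I_N.+1} * filling n N => glue lam p.1 p.2)
  (fun f => (second_diag f, peel f))) /=; last first.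
  by move=> f; rewrite inE => /andP[_ /eqP <-]; rewrite glue_peel.
under eq_bigl => p.
  rewrite inE diag_glue second_diag_glue peel_glue eqxx andbT -surjective_pairing eqxx andbT.
  rewrite plane_partition_glue.
  over.
rewrite -(pair_big_dep (fun kap : {ffun 'I_n.+1 -> 'I_N.+1} => between_diag (fun a => lam a) (fun a => kap a))
  (fun kap (g : filling n N) => between_next (fun a => kap a) (fun a => diag_fun g a) && plane_partition g)
  (fun _ _ => 1%N)) /=.
rewrite -(@sum_odd_sp_det N); first last.
- by move=> a; rewrite -ltnS.
- exact/mono_funP.
rewrite natr_sum; apply: eq_bigr => kap /forallP betw_kap.
have mono_kap : mono_fun (fun a => kap a).
  apply/mono_fun_adjP => i.
  have /andP[_] := betw_kap (prev_ord i).
  have /andP[+ _] := betw_kap (next_ord i).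
  move=> h1 h2; apply: leq_trans h2 (leq_trans _ h1).
  rewrite (_ : prev_ord (next_ord i) = lift ord0 (prev_ord i)) ?liftK //.
  by apply: ord_inj; rewrite prev_ordE next_ordE lift0 prev_ordE.
rewrite -(@sum_sp_det N); first last.
- by move=> a; rewrite -ltnS.
- exact: (elimT (mono_fun_adjP _) mono_kap).
rewrite (partition_big (fun g => diag_fun g)
   (fun mu : {ffun 'I_n -> 'I_N.+1} => between_next (fun a => kap a) (fun a => mu a))) /=; last first.
  by move=> g /andP[].
rewrite natr_sum; apply: eq_bigr => mu betw_mu.
rewrite -IHn.
  rewrite -sum1_card; congr (_%:R); apply: eq_bigl => g; rewrite inE.
  by case: eqP => [->|_]; rewrite ?betw_mu ?andbT ?andbF.
case: n {IHn mono_lam betw_kap lam} kap mu mono_kap betw_mu => [|n] kap mu mono_kap betw_mu.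
  by apply/mono_funP => -[].
apply/mono_fun_adjP => i; move/forallP: betw_mu => h.
have /andP[_ h1] := h (prev_ord i); have /andP[h2 _] := h (next_ord i).
apply: leq_trans h1 (leq_trans _ h2); apply: eq_leq; congr (nat_of_ord (kap _)).
by apply: ord_inj; rewrite prev_ordE !next_ordE prev_ordE.
Qed.

(** * Bounded sums of alternants: branching *)

Section BoundedSums.
Variables (F : realFieldType) (t : F) (K : nat).
Hypothesis t_gt0 : 0 < t.
Implicit Types (z : F) (a b c d m : nat).

Definition parity_weight n (lam : 'I_n -> nat) : F := \prod_i t ^+ odd (lam i).

(** The weights of two consecutive integers, the first of parity [a], in a sum
    over an interval. It measures how far a weighted sum over an interval that
    starts or ends at parity [a] is from being symmetric; see [step_sum_rev].
    *)
Definition chi z (a : nat) : F := t ^+ odd a + t ^+ (~~ odd a) * z.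

Lemma chi_gt0 z a : 0 < z -> 0 < chi z a.
Proof. by move=> z0; rewrite addr_gt0 ?mulr_gt0 ?exprn_gt0. Qed.

(** A weighted sum of powers over [m] consecutive integers, compared with its
    reversal. Both sides obey the same recursion in steps of 2 in [m], because
    parities repeat with period 2. *)
Lemma step_sum_rev z a m :
  (\sum_(0 <= k < m) t ^+ odd (a + k) * z ^+ k) * chi z (a + m).+1 =
  chi z a * \sum_(0 <= k < m) t ^+ odd (a + k) * z ^+ (m - k.+1).
Proof.
elim/ltn_ind: m a => -[|[|m]] IHm a.
- by rewrite !big_geq // mul0r mulr0.
- by rewrite !big_nat1 addn0 addn1 /chi /= negbK expr0; ring.
rewrite (@big_cat_nat _ _ _ 2) //= big_nat_recr // big_nat1 /=.
rewrite -{1}[2%N]add0n -{1}(addn2 m) big_addn addnK mulrDl.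
transitivity (chi z a * ((t ^+ odd (a + m) * z + t ^+ (~~ odd (a + m)))) + z ^+ 2 *
   ((\sum_(0 <= k < m) t ^+ odd (a + k) * z ^+ k) * chi z (a + m).+1)).
  congr (_ + _).
    rewrite addn0 addn1 /= !addnS /chi /= !negbK expr0 expr1; ring.
  rewrite mulrA; congr (_ * _); last by rewrite !addnS /chi /= !negbK.
  rewrite big_distrr /=; apply: eq_bigr => k _.
  by rewrite !addnS addn0 /= negbK !exprS expr0; ring.
rewrite IHm // mulrCA -mulrDr; congr (_ * _).
rewrite big_nat_recr // big_nat_recr //= subnn subSnn addnS /= expr0 expr1 mulr1.
rewrite -addrA addrC; congr (_ + _).
rewrite big_distrr /= !big_nat; apply: eq_bigr => k /= km.
by rewrite mulrCA -exprD; congr (_ * z ^+ _); lia.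
Qed.

Definition interval_sum z a b : F := \sum_(k < K.+1 | (a <= k <= b)%N) t ^+ odd k * z ^+ k.

Lemma interval_sum_rev z a b : z != 0 -> (b <= K)%N ->
  interval_sum z a b * chi z b = chi z a * z ^+ (a + b) * interval_sum z^-1 a b.
Proof.
move=> z0 bK; rewrite /interval_sum.
rewrite (@big_ord_between _ _ _ K a b (fun k => t ^+ odd k * z ^+ k)) //.
rewrite (@big_ord_between _ _ _ K a b (fun k => t ^+ odd k * z^-1 ^+ k)) //.
case: (leqP a b) => ab; last by rewrite !big_geq // mul0r mulr0.
rewrite -{1 4}[a]add0n !big_addn.
have := step_sum_rev z a (b.+1 - a); rewrite subnKC ?(leqW ab) //.
rewrite (_ : chi z b.+2 = chi z b) => [h|]; last by rewrite /chi /= !negbK.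
transitivity (z ^+ a * ((\sum_(0 <= k < b.+1 - a) t ^+ odd (a + k) * z ^+ k) * chi z b)).
  rewrite mulrA; congr (_ * _); rewrite big_distrr /=; apply: eq_bigr => k _.
  by rewrite mulrCA -exprD addnC.
rewrite h -mulrA mulrCA; congr (_ * _); rewrite !big_distrr /= !big_nat.
apply: eq_bigr => k /andP[_ kb]; rewrite [(k + a)%N]addnC ![_ * (t ^+ _ * _)]mulrCA; congr (_ * _).
apply: (mulIf (expf_neq0 (a + k) z0)).
by rewrite exprVn divfK ?expf_neq0 // -!exprD; congr (z ^+ _); lia.
Qed.


Definition bounded_fun n (c : nat) (f : 'I_n -> nat) : bool := [forall i, f i < c]%N.

(** The numerator in the bialternant formula for a Schur function, with
    increasing exponents. *)
Definition alternant n (x : 'I_n -> F) (lam : 'I_n -> nat) : F :=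
  \det (\matrix_(i, j) x j ^+ (lam i + i)).

Definition vandermonde n (x : 'I_n -> F) : F := \det (\matrix_(i, j) x j ^+ i).

(** The parts are less than [c], but taken in a type with the larger bound
    [K], so that sums for different [c] and the sums over interlacing
    sequences have the same index type. *)
Definition alternant_sum n c (x : 'I_n -> F) : F :=
  \sum_(lam : {ffun 'I_n -> 'I_K.+1} |
      mono_fun (fun i => lam i) && bounded_fun c (fun i => lam i))
    parity_weight (fun i => lam i) * alternant x (fun i => lam i).

Lemma det_scale (R : comRingType) n (a b : 'I_n -> R) (M : 'I_n -> 'I_n -> R) :
  \det (\matrix_(i, j) (a i * b j * M i j)) =
  (\prod_i a i) * (\prod_j b j) * \det (\matrix_(i, j) M i j).
Proof.
have -> : \matrix_(i, j) (a i * b j * M i j) =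
    diag_mx (\row_i a i) *m ((\matrix_(i, j) M i j) *m diag_mx (\row_j b j)).
  by apply/matrixP => i j; rewrite mul_diag_mx mxE mul_mx_diag !mxE; ring.
rewrite !det_mulmx !det_diag mulrA mulrAC.
by congr (_ * _ * _); apply: eq_bigr => i _; rewrite mxE.
Qed.

Lemma prod_exprD n z (f g : 'I_n -> nat) :
  \prod_i z ^+ (f i + g i) = z ^+ (\sum_i f i) * \prod_i z ^+ g i.
Proof. by rewrite expr_sum -big_split /=; apply: eq_bigr => i _; rewrite exprD. Qed.

(** The branching rule of Schur functions to one variable less, in terms of
    numerators: after division of the other variables by [x ord0], the column
    of [x ord0] consists of ones, and [det_row_diff] produces geometric sums
    over the gaps of [lam]. *)
Lemma alternant_branch n (x : 'I_n.+1 -> F) (lam : 'I_n.+1 -> nat) :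
  x ord0 != 0 -> mono_fun lam -> (forall i, lam i <= K)%N ->
  alternant x lam =
  \prod_j (x (next_ord j) - x ord0) *
  \sum_(mu : {ffun 'I_n -> 'I_K.+1} | between_next lam (fun j => mu j))
    alternant (fun j => x (next_ord j)) (fun j => mu j) *
    (x ord0 ^+ (\sum_i lam i) / x ord0 ^+ (\sum_j mu j)).
Proof.
set z := x ord0 => z0 /mono_fun_adjP mono_lam le_K.
pose y j := x (next_ord j) / z.
pose g (i : 'I_n.+1) (j : 'I_n) := y j ^+ (lam i + i).
transitivity ((\prod_i z ^+ (lam i + i)) *
    \det (\matrix_(i < n.+1, j < n.+1) oapp (g i) 1 (unlift ord0 j))).
  transitivity (\det (\matrix_(i < n.+1, j < n.+1)
      (z ^+ (lam i + i) * 1 * oapp (g i) 1 (unlift ord0 j)))).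
    congr (\det _); apply/matrixP => i j; rewrite !mxE mulr1.
    case: unliftP => [j'|] -> /=; last by rewrite mulr1.
    by rewrite /g /y expr_div_n mulrCA divff ?mulr1 // expf_neq0.
  by rewrite (det_scale _ (fun=> 1)) [\prod_(j < _) 1]big1 // mulr1.
rewrite det_row_diff.
transitivity ((\prod_i z ^+ (lam i + i)) *
    \det (\matrix_(i < n, j < n) \sum_(k < K.+1 | (lam (prev_ord i) <= k <= lam (next_ord i))%N)
       (y j ^+ (k + i) * (y j - 1)))).
  congr (_ * \det _); apply/matrixP => i j; rewrite !mxE.
  rewrite (@sum_between_diff _ K _ _ (fun k => y j ^+ (k + i) * (y j - 1))
    (fun k => y j ^+ (k + i))) ?leqW //.
    by rewrite /g prev_ordE next_ordE addnS.
  by move=> k; rewrite addSn exprS; ring.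
rewrite (det_row_sums
  (fun i (k : 'I_K.+1) => lam (prev_ord i) <= k <= lam (next_ord i))%N
  (fun i (k : 'I_K.+1) j => y j ^+ (k + i) * (y j - 1))).
rewrite !big_distrr /=; apply: eq_bigr => mu _.
have -> : \matrix_(i, j) (y j ^+ (mu i + i) * (y j - 1)) =
   \matrix_(i, j) ((z ^+ (mu i + i))^-1 * ((x (next_ord j) - z) / z) *
                   x (next_ord j) ^+ (mu i + i)).
  apply/matrixP => i j; rewrite !mxE /y expr_div_n mulrBl divff //.
  by rewrite [in RHS]mulrAC [_^-1 * _]mulrC.
rewrite det_scale big_split /= !prodfV prodr_const card_ord !prod_exprD [\prod_(i < n.+1) z ^+ i]big_ord_recr /=.
rewrite -/(alternant _ (fun j => mu j)); field.
rewrite !expf_neq0 //=; apply/prodf_neq0 => i _; exact: expf_neq0.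
Qed.

(** For fixed [mu], the parts of [lam] vary independently over the intervals
    between consecutive parts of [mu], completed by 0 and [c]; their joint sum
    is this product. *)
Definition interval_prod n c z (mu : 'I_n -> nat) : F :=
  \prod_(i < n.+1) interval_sum z (oapp mu 0%N (unlift ord0 i)) (oapp mu c (unlift ord_max i)).

Lemma interval_prodE n c z (mu : 'I_n -> nat) :
  interval_prod c z mu =
  \sum_(lam : {ffun 'I_n.+1 -> 'I_K.+1} |
      [forall i, oapp mu 0 (unlift ord0 i) <= lam i <= oapp mu c (unlift ord_max i)]%N)
    parity_weight (fun i => lam i) * z ^+ (\sum_i lam i).
Proof.
rewrite /interval_prod /interval_sum (bigA_distr_big_dep
  (fun i (k : 'I_K.+1) => oapp mu 0 (unlift ord0 i) <= k <= oapp mu c (unlift ord_max i))%N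
  (fun i (k : 'I_K.+1) => t ^+ odd k * z ^+ k)).
apply: eq_big => [lam|lam _]; first by apply/familyP/forallP.
by rewrite big_split /= -prodrXr.
Qed.

Lemma unlift_prev n (i : 'I_n) : unlift ord_max (prev_ord i) = Some i.
Proof. exact: liftK. Qed.

Lemma unlift_next n (i : 'I_n) : unlift ord0 (next_ord i) = Some i.
Proof. exact: liftK. Qed.

Lemma between_next_intervals n c (lam : 'I_n.+1 -> nat) (mu : 'I_n -> nat) :
  [&& mono_fun lam, bounded_fun c.+1 lam & between_next lam mu] =
  [forall i, oapp mu 0 (unlift ord0 i) <= lam i <= oapp mu c (unlift ord_max i)]%N.
Proof.
apply/and3P/forallP => [[_ /forallP bl /forallP il] i|h].
  apply/andP; split.
    by case: unliftP => [j ->|//] /=; have /andP[] := il j.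
  case: unliftP => [j ->|_] /=; last exact: bl.
  by have /andP[] := il j.
have il : between_next lam mu.
  apply/forallP => j.
  have /andP[_] := h (prev_ord j); have /andP[+ _] := h (next_ord j).
  by rewrite unlift_prev unlift_next /= => -> ->.
have ml : mono_fun lam.
  by apply/mono_fun_adjP => i; have /andP[] := forallP il i; exact: leq_trans.
split=> //; apply/forallP => i; rewrite ltnS.
apply: leq_trans (_ : lam ord_max <= c)%N.
  by move/mono_funP: ml; apply; rewrite -ltnS.
by have /andP[_] := h ord_max; rewrite unlift_none.
Qed.

(** In the weighted sum over [lam] followed by branching, the order of
    summation is exchanged. The first variable then enters only through
    products of interval sums. *)
Lemma alternant_sum_branch n c (x : 'I_n.+1 -> F) : (c <= K)%N -> x ord0 != 0 ->
  alternant_sum c.+1 x =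
  \prod_j (x (next_ord j) - x ord0) *
  \sum_(mu : {ffun 'I_n -> 'I_K.+1})
    alternant (fun j => x (next_ord j)) (fun j => mu j) *
    (interval_prod c (x ord0) (fun j => mu j) / x ord0 ^+ (\sum_j mu j)).
Proof.
move=> cK z0; rewrite /alternant_sum.
pose A (lam : 'I_n.+1 -> nat) (mu : {ffun 'I_n -> 'I_K.+1}) :=
  parity_weight lam * (alternant (fun j => x (next_ord j)) (fun j => mu j) *
            (x ord0 ^+ (\sum_i lam i) / x ord0 ^+ (\sum_j mu j))).
rewrite (eq_bigr (fun lam : {ffun 'I_n.+1 -> 'I_K.+1} => \prod_j (x (next_ord j) - x ord0) *
    \sum_(mu : {ffun 'I_n -> 'I_K.+1} | between_next (fun i => lam i) (fun j => mu j)) A (fun i => lam i) mu)); last first.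
  move=> lam /andP[ml _].
  rewrite alternant_branch //; last by move=> i; rewrite -ltnS.
  by rewrite mulrCA [X in _ * X]big_distrr.
rewrite -big_distrr /=; congr (_ * _); rewrite /A {A}.
rewrite (exchange_big_dep xpredT) //=; apply: eq_bigr => mu _.
move: (alternant _ _) => al; rewrite interval_prodE mulr_suml mulr_sumr; apply: eq_big => [lam|lam _]; last by ring.
by rewrite -andbA (between_next_intervals c (fun i => lam i) (fun j => mu j)).
Qed.
End BoundedSums.

(** * Bounded sums of alternants: inversion of a variable *)

Section Inversion.
Variables (F : realFieldType) (t : F) (K : nat).
Hypothesis t_gt0 : 0 < t.
Implicit Types (z : F) (a b c d m : nat).

(** Reversing every interval multiplies the product by ratios of values of
    [chi] at the ends of the intervals. Each part of [mu] ends one interval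
    and begins the next, so only the ends 0 and [c] of the whole range
    survive. *)
Lemma interval_prod_rev n c z (mu : 'I_n -> nat) :
  (forall j, mu j <= K)%N -> (c <= K)%N -> 0 < z ->
  chi t z c * (interval_prod t K c z mu / z ^+ (\sum_j mu j)) =
  z ^+ c * chi t z 0 * (interval_prod t K c z^-1 mu / z^-1 ^+ (\sum_j mu j)).
Proof.
move=> muK cK z0; have zn0 : z != 0 by rewrite gt_eqF.
pose lo (i : 'I_n.+1) := oapp mu 0%N (unlift ord0 i).
pose hi (i : 'I_n.+1) := oapp mu c (unlift ord_max i).
have chi_lo : \prod_i chi t z (lo i) = chi t z 0 * \prod_j chi t z (mu j).
  rewrite big_ord_recl /lo unlift_none; congr (_ * _).
  by apply: eq_bigr => j _; rewrite liftK.
have widenE j : widen_ord (leqnSn n) j = lift ord_max j.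
  by apply: ord_inj; rewrite lift_max.
have chi_hi : \prod_i chi t z (hi i) = (\prod_j chi t z (mu j)) * chi t z c.
  rewrite big_ord_recr /hi unlift_none; congr (_ * _).
  by apply: eq_bigr => j _; rewrite widenE liftK.
have sum_lo : (\sum_i lo i = \sum_j mu j)%N.
  rewrite big_ord_recl /lo unlift_none add0n.
  by apply: eq_bigr => j _; rewrite liftK.
have sum_hi : (\sum_i hi i = \sum_j mu j + c)%N.
  rewrite big_ord_recr /hi unlift_none; congr (_ + _)%N.
  by apply: eq_bigr => j _; rewrite widenE liftK.
have chi_mu : \prod_j chi t z (mu j) != 0.
  by apply/prodf_neq0 => j _; rewrite gt_eqF // chi_gt0.
have rev : interval_prod t K c z mu * \prod_i chi t z (hi i) =
    (\prod_i chi t z (lo i)) * z ^+ (\sum_i (lo i + hi i)) * interval_prod t K c z^-1 mu.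
  rewrite /interval_prod expr_sum -!big_split /=; apply: eq_bigr => i _.
  by rewrite interval_sum_rev // /hi; case: (unlift _ _) => [j|] /=; rewrite ?muK.
have {}rev : interval_prod t K c z mu * chi t z c =
    chi t z 0 * z ^+ (\sum_i (lo i + hi i)) * interval_prod t K c z^-1 mu.
  apply: (mulIf chi_mu); rewrite mulrAC [LHS]mulrC.
  rewrite chi_lo chi_hi in rev.
  transitivity (chi t z 0 * (\prod_j chi t z (mu j)) * z ^+ (\sum_i (lo i + hi i)) * interval_prod t K c z^-1 mu).
    by rewrite -rev; ring.
  by ring.
rewrite mulrA [chi t z c * _]mulrC rev big_split /= sum_lo sum_hi !exprD exprVn invrK.
by field; exact: expf_neq0.
Qed.

Lemma vandermonde_cons n (x : 'I_n.+1 -> F) :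
  vandermonde x = \prod_j (x (next_ord j) - x ord0) * vandermonde (fun j => x (next_ord j)).
Proof.
rewrite /vandermonde !det_monomials big_ord_recl; congr (_ * _).
  by rewrite big_mkcond big_ord_recl /= mul1r.
apply: eq_bigr => i _; rewrite big_mkcond big_ord_recl /= mul1r [RHS]big_mkcond.
by apply: eq_bigr => j _; rewrite /bump /= !add1n ltnS.
Qed.

(** A sum of Schur functions over the partitions in a box; as such it is
    symmetric in the variables. *)
Definition normalized_sum n c (x : 'I_n -> F) := alternant_sum t K c.+1 x / vandermonde x.

(** In the branched sum only the factors [interval_prod] and the differences with
    [x ord0], which the Vandermonde determinant cancels, depend on the first
    variable; [interval_prod_rev] controls the former. *)
Lemma normalized_sum_flip0 n c (x x' : 'I_n.+1 -> F) :
  (c <= K)%N -> 0 < x ord0 -> x' ord0 = (x ord0)^-1 ->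
  (forall j, x' (next_ord j) = x (next_ord j)) ->
  vandermonde x != 0 -> vandermonde x' != 0 ->
  chi t (x ord0) c * normalized_sum c x =
  x ord0 ^+ c * chi t (x ord0) 0 * normalized_sum c x'.
Proof.
move=> cK x0 x'0 x'j; rewrite /normalized_sum !vandermonde_cons.
rewrite !mulf_eq0 !negb_or => /andP[vx vy] /andP[vx' _].
have xn0 : x ord0 != 0 by rewrite gt_eqF.
rewrite !alternant_sum_branch //; last by rewrite x'0 invr_eq0.
rewrite -!mulf_div !divff // !mul1r !mulrA.
have alt_ext (mu : 'I_n -> nat) :
    alternant (fun j => x' (next_ord j)) mu = alternant (fun j => x (next_ord j)) mu.
  by congr (\det _); apply/matrixP => i j; rewrite !mxE x'j.
have -> : vandermonde (fun j => x' (next_ord j)) = vandermonde (fun j => x (next_ord j)).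
  by congr (\det _); apply/matrixP => i j; rewrite !mxE x'j.
congr (_ / _); rewrite !big_distrr /=; apply: eq_bigr => mu _.
rewrite alt_ext x'0 mulrCA interval_prod_rev //; last by move=> j; rewrite -ltnS.
by rewrite [RHS]mulrCA.
Qed.

Lemma det_col_permE n (f : 'I_n -> 'I_n -> F) (s : {perm 'I_n}) :
  \det (\matrix_(i, j) f i (s j)) = (-1) ^+ s * \det (\matrix_(i, j) f i j).
Proof.
have -> : \matrix_(i, j) f i (s j) = col_perm s (\matrix_(i, j) f i j).
  by apply/matrixP => i j; rewrite !mxE.
by rewrite col_permE det_mulmx det_perm odd_permV mulrC.
Qed.

Lemma normalized_sum_perm n c (x : 'I_n -> F) (s : {perm 'I_n}) :
  normalized_sum c (fun j => x (s j)) = normalized_sum c x.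
Proof.
rewrite /normalized_sum /alternant_sum.
rewrite /vandermonde (det_col_permE (fun i j => x j ^+ i)).
transitivity ((-1) ^+ s * alternant_sum t K c.+1 x / ((-1) ^+ s * vandermonde x)).
  congr (_ / _); rewrite /alternant_sum mulr_sumr; apply: eq_bigr => lam _.
  by rewrite mulrCA; congr (_ * _); apply: (det_col_permE (fun i j => x j ^+ (lam i + i))).
by rewrite -mulf_div divff ?mul1r // signr_eq0.
Qed.

(** The factor that remains when the sum in a box is made invariant under
    inversion. For odd [c] it is not a monomial, because the parity weights of
    the two ends of the box differ. *)
Definition psi c z : F := z ^+ c./2 * (if odd c then 1 + t * z else 1).

Lemma psi_gt0 c z : 0 < z -> 0 < psi c z.
Proof.
move=> z0; rewrite mulr_gt0 ?exprn_gt0 //.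
by case: ifP => _ //; rewrite addr_gt0 ?mulr_gt0.
Qed.

Lemma chi_psi c z : 0 < z ->
  chi t z c * psi c z = z ^+ c * chi t z 0 * psi c z^-1.
Proof.
move=> z0; have zn0 : z != 0 by rewrite gt_eqF.
have -> : z ^+ c = z ^+ odd c * z ^+ c./2 * z ^+ c./2.
  by rewrite -!exprD -addnA addnn odd_double_half.
rewrite /psi /chi /= exprVn.
by case: (odd c); rewrite /= !expr0 !expr1; field; rewrite ?zn0 ?expf_neq0.
Qed.

Definition flip n (x : 'I_n -> F) (e : {ffun 'I_n -> bool}) (j : 'I_n) : F :=
  if e j then (x j)^-1 else x j.

Lemma vandermonde_neq0 n (x : 'I_n -> F) : injective x -> vandermonde x != 0.
Proof.
move=> inj; rewrite /vandermonde det_monomials.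
apply/prodf_neq0 => i _; apply/prodf_neq0 => j ij; rewrite subr_eq0.
by apply/eqP => /inj ji; rewrite ji ltnn in ij.
Qed.

Lemma flip_inj n (x : 'I_n -> F) (e : {ffun 'I_n -> bool}) :
  (forall j, 1 < x j) -> injective x -> injective (flip x e).
Proof.
move=> x1 inj i j; rewrite /flip.
have lt1 k : (x k)^-1 < 1 by rewrite invf_lt1 ?(lt_trans ltr01).
case: (e i) (e j) => -[] //.
- by move/invr_inj/inj.
- by move=> h; have := lt_trans (lt1 i) (x1 j); rewrite h ltxx.
- by move=> h; have := lt_trans (lt1 j) (x1 i); rewrite h ltxx.
- exact: inj.
Qed.

Lemma flip_gt0 n (x : 'I_n -> F) (e : {ffun 'I_n -> bool}) j :
  (forall j, 1 < x j) -> 0 < flip x e j.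
Proof.
by move=> x1; rewrite /flip; case: ifP => _; rewrite ?invr_gt0 (lt_trans ltr01).
Qed.

(** By [normalized_sum_flip0] and symmetry, inverting any single variable
    multiplies the sum by the quotient of the values of [psi]; inverting
    several variables follows by induction on their number. *)
Lemma normalized_sum_flip n c (x : 'I_n -> F) (e : {ffun 'I_n -> bool}) :
  (c <= K)%N -> (forall j, 1 < x j) -> injective x ->
  normalized_sum c (flip x e) / \prod_j psi c (flip x e j) =
  normalized_sum c x / \prod_j psi c (x j).
Proof.
move=> cK x1 inj; move sz: #|[set j | e j]| => k.
elim: k e sz => [|k IHk] e sz.
  have fx : flip x e =1 x.
    move=> j; rewrite /flip; case: ifP => // ej.
    by move/cards0_eq/setP/(_ j): sz; rewrite !inE ej.
  congr (_ / _); last by apply: eq_bigr => j _; rewrite fx.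
  rewrite /normalized_sum /alternant_sum; congr (_ / _).
    apply: eq_bigr => lam _; congr (_ * \det _).
    by apply/matrixP => i j; rewrite !mxE fx.
  by congr (\det _); apply/matrixP => i j; rewrite !mxE fx.
have [j0 ej0] : exists j, e j.
  have /card_gt0P[j] : (0 < #|[set j | e j]|)%N by rewrite sz.
  by rewrite inE => ej; exists j.
pose e' := [ffun j => (j != j0) && e j].
rewrite -(IHk e'); last first.
  move: sz; rewrite (cardsD1 j0) inE ej0 add1n => -[<-].
  by apply: eq_card => j; rewrite !inE ffunE.
have fne j : j != j0 -> flip x e j = flip x e' j.
  by move=> h; rewrite /flip ffunE h.
have fj0 : flip x e j0 = (flip x e' j0)^-1.
  by rewrite /flip ffunE eqxx ej0.
case: n x e x1 inj sz j0 ej0 e' fne fj0 {IHk} => [|n] x e x1 inj sz j0 ej0 e' fne fj0.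
  by have := ltn_ord j0.
pose s := tperm ord0 j0.
have pos : 0 < flip x e' j0 by apply: flip_gt0.
have vne (u : {ffun 'I_n.+1 -> bool}) : vandermonde (fun j => flip x u (s j)) != 0.
  by apply: vandermonde_neq0 => i j /(flip_inj x1 inj) /perm_inj.
have key := @normalized_sum_flip0 n c (fun j => flip x e' (s j)) (fun j => flip x e (s j)).
rewrite !normalized_sum_perm tpermL in key.
have {}key := key cK pos fj0 _ (vne _) (vne _).
rewrite (bigD1 j0) //= [in RHS](bigD1 j0) //= fj0.
rewrite (eq_bigr (fun j => psi c (flip x e' j))); last by move=> j jj0; rewrite fne.
set P := \prod_(j | _) _.
have Pn0 : P != 0 by apply/prodf_neq0 => j _; rewrite gt_eqF // psi_gt0 // flip_gt0.
have {}key : chi t (flip x e' j0) c * normalized_sum c (flip x e') =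
    flip x e' j0 ^+ c * chi t (flip x e' j0) 0 * normalized_sum c (flip x e).
  apply: key => j; rewrite -fne // /s; apply/eqP => h.
  by have := tpermL ord0 j0; rewrite -[X in _ = X]h => /perm_inj.
have h := chi_psi c pos.
have p1 : psi c (flip x e' j0) != 0 by rewrite gt_eqF // psi_gt0.
have p2 : psi c (flip x e' j0)^-1 != 0 by rewrite gt_eqF // psi_gt0 // invr_gt0.
have p3 : chi t (flip x e' j0) c != 0 by rewrite gt_eqF // chi_gt0.
apply: (mulfI p3); apply: (mulfI p1); apply: (mulfI p2); apply: (mulfI Pn0).
set z := flip x e' j0 in key h p1 p2 p3 *.
transitivity (chi t z c * psi c z * normalized_sum c (flip x e)).
  by field; rewrite p2 Pn0.
rewrite h; transitivity (psi c z^-1 * (chi t z c * normalized_sum c (flip x e'))).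
  by rewrite key; ring.
by field; rewrite p1 Pn0.
Qed.

End Inversion.

(** * Bounded sums of symplectic numerators *)

(** Scaling row [i] by $(-t)^i$ turns the sums of adjacent rows into
    differences, so that [det_row_diff] identifies the left side with a
    determinant with one more row and a column of ones; its expansion along
    that column is the right side. *)
Lemma det_adjacent_sums (F : fieldType) (t : F) n (r : nat -> 'I_n -> F) : t != 0 ->
  \det (\matrix_(i, j) (r i j + t * r i.+1 j)) =
  \sum_(p < n.+1) t ^+ (n - p) * \det (\matrix_(i, j) r (lift p i) j).
Proof.
move=> t0; have nt0 : - t != 0 by rewrite oppr_eq0.
pose g (i : 'I_n.+1) (j : 'I_n) : F := (- t) ^+ i * r i j.
have := det_row_diff g.
set A := \matrix_(i, j) oapp _ _ _.
pose P := \prod_(i < n) (- t) ^+ i.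
have Pn0 : P != 0 by apply/prodf_neq0 => i _; apply: expf_neq0.
have -> : \matrix_(i, j) (g (next_ord i) j - g (prev_ord i) j) =
    \matrix_(i, j) (- (- t) ^+ i * 1 * (r i j + t * r i.+1 j)).
  by apply/matrixP => i j; rewrite !mxE /g prev_ordE next_ordE exprS; ring.
rewrite (det_scale (fun i : 'I_n => - (- t) ^+ i) (fun=> 1)) [\prod_(j < _) 1]big1 // mulr1.
rewrite prodrN card_ord -/P (expand_det_col _ ord0) => h.
have {}h : \sum_(p < n.+1) (-1) ^+ p * (P * (- t) ^+ (n - p) * \det (\matrix_(i, j) r (lift p i) j)) =
    (-1) ^+ n * P * \det (\matrix_(i, j) (r i j + t * r i.+1 j)).
  rewrite -h; apply: eq_bigr => p _.
  rewrite mxE unlift_none mul1r /cofactor addn0; congr (_ * _).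
  have -> : row' p (col' ord0 A) = \matrix_(i, j) ((- t) ^+ lift p i * 1 * r (lift p i) j).
    by apply/matrixP => i j; rewrite !mxE liftK /g /= mulr1.
  rewrite (det_scale (fun i : 'I_n => (- t) ^+ lift p i) (fun=> 1)) [\prod_(j < _) 1]big1 // mulr1.
  congr (_ * _); apply: (mulIf (expf_neq0 p nt0)).
  rewrite -mulrA -exprD subnK -1?ltnS // [RHS]mulrC.
  rewrite -(@bigD1_ord _ _ _ _ p xpredT (fun i : 'I_n.+1 => (- t) ^+ i)) //.
  by rewrite big_ord_recr.
have sn0 : (-1) ^+ n * P != 0 by rewrite mulf_neq0 // signr_eq0.
apply: (mulfI sn0); rewrite -h mulr_sumr; apply: eq_bigr => p _.
rewrite -[in (- t) ^+ _]mulN1r exprMn !mulrA; congr (_ * _ * _).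
rewrite mulrAC; congr (_ * _); rewrite -exprD subnKC // -ltnS //.
Qed.

Section Characters.
Variables (F : realFieldType) (t : F) (K : nat).
Hypothesis t_gt0 : 0 < t.
Implicit Types (z : F) (a b c d m : nat) (M : int).

Definition odd_pow z (l : int) : F := z ^ l - z ^ (- l).

(** The numerator of the Weyl character formula for Sp(2n), at the shifted
    weight [l]. *)
Definition sp_numerator n (x : 'I_n -> F) (l : 'I_n -> int) : F :=
  \det (\matrix_(i, j) odd_pow (x j) (l i)).

Lemma eq_sp_numerator n (x : 'I_n -> F) (l l' : 'I_n -> int) :
  l =1 l' -> sp_numerator x l = sp_numerator x l'.
Proof. by move=> e; congr (\det _); apply/matrixP => i j; rewrite !mxE e. Qed.

(** The offset [M] is an integer of any sign: a range symmetric about 0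
    determines the factor that does not depend on [M]. *)
Definition sp_sum n M c (x : 'I_n -> F) : F :=
  \sum_(lam : {ffun 'I_n -> 'I_K.+1} |
      mono_fun (fun i => lam i) && bounded_fun c (fun i => lam i))
    parity_weight t (fun i => lam i) * sp_numerator x (fun i => M + 1 + (lam i + i)%N%:Z).

(** Each column is a difference of a value at [x j] and a value at its
    inverse; expanding gives a signed sum over all inversions. *)
Lemma det_flip_sum n (x : 'I_n -> F) (h : 'I_n -> F -> F) :
  \det (\matrix_(i, j) (h i (x j) - h i (x j)^-1)) =
  \sum_(e : {ffun 'I_n -> bool})
    (\prod_j (-1) ^+ e j) * \det (\matrix_(i, j) h i (flip x e j)).
Proof.
rewrite -det_tr.
transitivity (\det (\matrix_(j, i) \sum_(b : bool | true)
    (-1) ^+ b * h i (if b then (x j)^-1 else x j))).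
  congr (\det _); apply/matrixP => j i; rewrite !mxE big_bool /= expr0 expr1.
  by rewrite mul1r mulN1r addrC.
rewrite (det_row_sums (fun _ _ => true)
  (fun j (b : bool) i => (-1) ^+ b * h i (if b then (x j)^-1 else x j))).
apply: eq_big => [e|e _]; first by apply/forallP.
rewrite -det_tr; transitivity (\det (\matrix_(i, j) (1 * (-1) ^+ e j * h i (flip x e j)))).
  by congr (\det _); apply/matrixP => i j; rewrite !mxE mul1r.
by rewrite (det_scale (fun=> 1) (fun j : 'I_n => (-1) ^+ e j)) [\prod_(j < _) 1]big1 // mul1r.
Qed.

(** The numerator is expanded over the inversions of the variables. The inner
    weighted sum of alternants is, up to the values of [psi] and the
    Vandermonde determinant, the same for all inversions by
    [normalized_sum_flip], and can be taken out. It does not involve [M],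
    which only shifts all exponents. *)
Lemma sp_sum_factor n c (x : 'I_n -> F) :
  (c <= K)%N -> (forall j, 1 < x j) -> injective x ->
  exists G, forall M, sp_sum M c.+1 x =
    G * \det (\matrix_(i, j) (x j ^ (M + 1) * psi t c (x j) * x j ^+ i -
                             (x j)^-1 ^ (M + 1) * psi t c (x j)^-1 * (x j)^-1 ^+ i)).
Proof.
move=> cK x1 inj.
exists (normalized_sum t K c x / \prod_j psi t c (x j)) => M.
rewrite (det_flip_sum x (fun i z => z ^ (M + 1) * psi t c z * z ^+ i)) mulr_sumr.
transitivity (\sum_(lam : {ffun 'I_n -> 'I_K.+1} |
      mono_fun (fun i => lam i) && bounded_fun c.+1 (fun i => lam i))
    \sum_(e : {ffun 'I_n -> bool}) parity_weight t (fun i => lam i) *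
      (\prod_j (-1) ^+ e j * \det (\matrix_(i, j) flip x e j ^ (M + 1 + (lam i + i)%N%:Z)))).
  apply: eq_bigr => lam _; rewrite -mulr_sumr; congr (_ * _).
  rewrite -(det_flip_sum x (fun i z => z ^ (M + 1 + (lam i + i)%N%:Z))).
  by congr (\det _); apply/matrixP => i j; rewrite !mxE /odd_pow exprz_inv.
rewrite exchange_big /=; apply: eq_bigr => e _.
have fn0 j : flip x e j != 0 by rewrite gt_eqF // flip_gt0.
have pn0 : \prod_j psi t c (flip x e j) != 0.
  by apply/prodf_neq0 => j _; rewrite gt_eqF // psi_gt0 // flip_gt0.
have vn0 : vandermonde (flip x e) != 0 by apply/vandermonde_neq0/flip_inj.
rewrite -(normalized_sum_flip t_gt0 e cK x1 inj).
transitivity ((\prod_j (-1) ^+ e j) * (\prod_j (flip x e j ^ (M + 1))) *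
   alternant_sum t K c.+1 (flip x e)).
  rewrite /alternant_sum mulr_sumr; apply: eq_bigr => lam _.
  rewrite mulrCA -!mulrA; congr (_ * _); rewrite mulrCA; congr (_ * _).
  transitivity (\det (\matrix_(i, j) (1 * (flip x e j) ^ (M + 1) * flip x e j ^+ (lam i + i)))).
    by congr (\det _); apply/matrixP => i j; rewrite !mxE mul1r expfzDr.
  by rewrite (det_scale (fun=> 1) (fun j => flip x e j ^ (M + 1))) [\prod_(j < _) 1]big1 // mul1r.
have -> : \matrix_(i < n, j < n) (flip x e j ^ (M + 1) * psi t c (flip x e j) * flip x e j ^+ i) =
   \matrix_(i, j) (1 * (flip x e j ^ (M + 1) * psi t c (flip x e j)) * flip x e j ^+ i).
  by apply/matrixP => i j; rewrite !mxE mul1r.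
rewrite (det_scale (fun=> 1) (fun j => flip x e j ^ (M + 1) * psi t c (flip x e j))).
rewrite [\prod_(j < _) 1]big1 // mul1r [\prod_(j < _) (_ ^ (M + 1) * _)]big_split /= /normalized_sum -[\det _]/(vandermonde (flip x e)).
by field; rewrite vn0 pn0.
Qed.

Lemma sp_sum_even n d (x : 'I_n -> F) :
  (d.*2 <= K)%N -> (forall j, 1 < x j) -> injective x ->
  exists G, forall M, sp_sum M d.*2.+1 x = G * sp_numerator x (fun i => M + 1 + (d + i)%N%:Z).
Proof.
move=> dK x1 inj; have [G hG] := sp_sum_factor dK x1 inj; exists G => M.
rewrite hG; congr (_ * \det _); apply/matrixP => i j; rewrite !mxE /odd_pow /psi.
have xn0 : x j != 0 by rewrite gt_eqF // (lt_trans ltr01).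
rewrite odd_double doubleK !mulr1 -!mulrA -!exprD -exprz_inv !expfzDr ?invr_eq0 //.
Qed.

Lemma sp_sum_odd n d (x : 'I_n -> F) :
  (d.*2.+1 <= K)%N -> (forall j, 1 < x j) -> injective x ->
  exists G, forall M, sp_sum M d.*2.+2 x =
    G * \sum_(p < n.+1) t ^+ (n - p) *
      sp_numerator x (fun i => M + 1 + (d + lift p i)%N%:Z).
Proof.
move=> dK x1 inj; have [G hG] := sp_sum_factor dK x1 inj; exists G => M.
rewrite hG -(det_adjacent_sums (fun k j => odd_pow (x j) (M + 1 + (d + k)%N%:Z))) ?gt_eqF //.
congr (_ * \det _); apply/matrixP => i j; rewrite !mxE /odd_pow /psi.
have xn0 : x j != 0 by rewrite gt_eqF // (lt_trans ltr01).
rewrite /= odd_double uphalf_double -!exprz_inv !expfzDr ?invr_eq0 //.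
rewrite addnS -!exprnP !exprS !exprD /= expr0; move: (x j)^-1 => y; ring.
Qed.

Lemma odd_pow0 z : odd_pow z 0 = 0.
Proof. by rewrite /odd_pow oppr0 subrr. Qed.

Lemma sp_numerator_eq0 n (x : 'I_n -> F) (l : 'I_n -> int) i : l i = 0 -> sp_numerator x l = 0.
Proof.
move=> li; rewrite /sp_numerator (expand_det_row _ i) big1 // => j _.
by rewrite mxE li odd_pow0 mul0r.
Qed.

Lemma sp_numerator_expand n (x : 'I_n.+1 -> F) (l : 'I_n.+1 -> int) :
  sp_numerator x l = \sum_(j < n.+1) (-1) ^+ (n + j) * odd_pow (x j) (l ord_max) *
    sp_numerator (fun k => x (lift j k)) (fun i => l (prev_ord i)).
Proof.
rewrite /sp_numerator (expand_det_row _ ord_max); apply: eq_bigr => j _.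
rewrite mxE /cofactor mulrA [_ * (-1) ^+ _]mulrC; congr (_ * \det _).
by apply/matrixP => i k; rewrite !mxE.
Qed.

(** Splitting off the terms whose largest part is [c], by expanding the
    numerator along the last row. *)
Lemma sp_sum_top n M c (x : 'I_n.+1 -> F) : (c <= K)%N ->
  sp_sum M c.+1 x =
  t ^+ odd c * (\sum_(j < n.+1) (-1) ^+ (n + j) * odd_pow (x j) (M + 1 + (c + n)%N%:Z) *
    sp_sum M c.+1 (fun k => x (lift j k))) + sp_sum M c x.
Proof.
move=> cK; rewrite {1}/sp_sum (bigID (fun lam : {ffun 'I_n.+1 -> 'I_K.+1} => lam ord_max == c :> nat)) /=.
congr (_ + _); last first.
  apply: eq_bigl => lam; rewrite -andbA; case: (boolP (mono_fun _)) => //= /mono_funP ml.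
  apply/andP/forallP => [[/forallP h h'] i|h].
    apply: leq_ltn_trans (ml i ord_max _) _; first by rewrite -ltnS.
    by rewrite ltn_neqAle h' /= -ltnS; apply: h.
  split; last by rewrite ltn_eqF.
  by apply/forallP => i; rewrite ltnS ltnW.
pose ext (lam : {ffun 'I_n -> 'I_K.+1}) : {ffun 'I_n.+1 -> 'I_K.+1} :=
  [ffun i => oapp lam (inord c) (unlift ord_max i)].
pose res (lam : {ffun 'I_n.+1 -> 'I_K.+1}) : {ffun 'I_n -> 'I_K.+1} :=
  [ffun j => lam (prev_ord j)].
have ext_max lam : ext lam ord_max = c :> nat.
  by rewrite ffunE unlift_none /= inordK.
have ext_prev lam j : ext lam (prev_ord j) = lam j by rewrite ffunE unlift_prev.
rewrite (reindex_onto ext res) /=; last first.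
  move=> lam /andP[_ /eqP top]; apply/ffunP => i; rewrite ffunE.
  case: unliftP => [j|] -> /=; first by rewrite ffunE.
  by apply: ord_inj; rewrite inordK // top.
under [in RHS]eq_bigr do rewrite /sp_sum mulr_sumr.
rewrite exchange_big mulr_sumr /=; apply: eq_big => [lam|lam _].
  have -> : res (ext lam) == lam by apply/eqP/ffunP => j; rewrite ffunE ext_prev.
  rewrite ext_max eqxx !andbT; apply/andP/andP => [[/mono_funP m /forallP b]|[/mono_funP m /forallP b]].
    split; [apply/mono_funP => i j ij|apply/forallP => i].
      by have := m (prev_ord i) (prev_ord j); rewrite !ext_prev !prev_ordE; apply.
    by have := b (prev_ord i); rewrite ext_prev.
  have cases (i : 'I_n.+1) : i = ord_max \/ exists j, i = prev_ord j.
    by case: (unliftP ord_max i) => [j|] ->; [right; exists j|left].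
  split; [apply/mono_funP => i j ij|apply/forallP => i].
    have [->|[j' ej]] := cases j.
      rewrite ext_max; have [->|[i' ->]] := cases i; first by rewrite ext_max.
      by rewrite ext_prev -ltnS.
    have [ei|[i' ei]] := cases i.
      by move: ij; rewrite ei ej prev_ordE /= leqNgt ltn_ord.
    by rewrite ei ej !ext_prev m // -(prev_ordE i') -(prev_ordE j') -ei -ej.
  by have [->|[j ->]] := cases i; rewrite ?ext_max ?ext_prev.
rewrite sp_numerator_expand /parity_weight big_ord_recr /= ext_max -mulrA mulrCA; congr (_ * _).
rewrite mulr_sumr; apply: eq_bigr => j _.
rewrite mulrCA; congr (_ * _).
congr (_ * _); last by apply: eq_sp_numerator => i; rewrite ext_prev -[bump n i]/(nat_of_ord (prev_ord i)) prev_ordE.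
apply: eq_bigr => i _; rewrite -ext_prev; congr (t ^+ odd (ext lam _)).
by apply: ord_inj; rewrite prev_ordE.
Qed.

Lemma sp_sum_size0 M c (x : 'I_0 -> F) : sp_sum M c x = 1.
Proof.
rewrite /sp_sum (big_pred1 [ffun=> ord0]) => [|lam].
  by rewrite /parity_weight big_ord0 mul1r /sp_numerator det_mx00.
rewrite /= (_ : lam == _ = true); last by apply/eqP/ffunP => -[].
by apply/andP; split; apply/forallP => -[].
Qed.

(** For this [M] the rectangular numerator of [sp_sum_even] has a zero row. *)
Lemma sp_sum_vanish n d (x : 'I_n.+1 -> F) :
  (d.*2 <= K)%N -> (forall j, 1 < x j) -> injective x ->
  sp_sum (- d.+1%:Z) d.*2.+1 x = 0.
Proof.
move=> dK x1 inj; have [G ->] := sp_sum_even dK x1 inj.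
by rewrite (@sp_numerator_eq0 _ x _ ord0) ?mulr0 //= addn0; lia.
Qed.

(** By [sp_sum_top], the largest part is either maximal or the remaining sum
    vanishes by [sp_sum_vanish]; only the constant sequence survives. *)
Lemma sp_sum_balanced_odd n d (x : 'I_n -> F) :
  (d.*2.+1 <= K)%N -> (forall j, 1 < x j) -> injective x ->
  sp_sum (- d.+1%:Z) d.*2.+2 x = t ^+ n * sp_numerator x (fun i => (d.+1 + i)%N%:Z).
Proof.
move=> dK; elim: n x => [|n IHn] x x1 inj.
  by rewrite sp_sum_size0 /sp_numerator det_mx00 mulr1.
rewrite sp_sum_top // sp_sum_vanish ?addr0 //; last exact: ltnW.
rewrite /= odd_double /= expr1 exprS -mulrA; congr (_ * _); rewrite sp_numerator_expand mulr_sumr.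
apply: eq_bigr => j _; rewrite IHn //; last by move=> a b /inj /lift_inj.
rewrite mulrCA; congr (_ * (_ * _ * _)); last by apply: eq_sp_numerator => i; rewrite prev_ordE.
congr (odd_pow _ _); rewrite /=; lia.
Qed.

(** If the largest part is not maximal, [sp_sum_balanced_odd] leaves one
    constant sequence; otherwise it is split off and the induction goes on.
    Thus only sequences with parts $d-1$ and $d$ survive, and their shifted
    weights are $d,\dots,d+n$ with one value omitted. *)
Lemma sp_sum_balanced_even n d (x : 'I_n -> F) :
  (d.*2 <= K)%N -> (forall j, 1 < x j) -> injective x ->
  sp_sum (- d%:Z) d.*2.+1 x =
  \sum_(p < n.+1) t ^+ p * sp_numerator x (fun i => (d + lift p i)%N%:Z).
Proof.
move=> dK; elim: n x => [|n IHn] x x1 inj.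
  by rewrite sp_sum_size0 big_ord1 /sp_numerator det_mx00 mulr1.
rewrite sp_sum_top // [RHS]big_ord_recr /=; congr (_ + _); last first.
  (* For d = 0 the remaining sum is empty, and the numerator has a zero row. *)
  case: d dK {IHn} => [|d] dK.
    rewrite (@sp_numerator_eq0 _ x _ ord0) ?mulr0 // /sp_sum big1 // => lam /andP[_ /forallP].
    by move/(_ ord0).
  rewrite doubleS sp_sum_balanced_odd //; last by rewrite doubleS in dK; apply: ltnW.
  by congr (_ * _); apply: eq_sp_numerator => i; rewrite /= /bump leqNgt ltn_ord.
rewrite odd_double expr0 mul1r.
under [in LHS]eq_bigr => j _.
  rewrite IHn; [|by []|by move=> a b /inj /lift_inj].
  rewrite mulr_sumr.
  over.
rewrite exchange_big; apply: eq_bigr => p _ /=.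
rewrite sp_numerator_expand mulr_sumr; apply: eq_bigr => j _.
rewrite mulrCA; congr (_ * (_ * _ * _)).
  congr (odd_pow _ _); rewrite /= /bump /=.
  by have := ltn_ord p; rewrite ltnS => ->; lia.
by apply: eq_sp_numerator => i; rewrite /= /bump /= [(n <= i)%N]leqNgt ltn_ord.
Qed.

(** The factor independent of [M] in [sp_sum_even] is read off at $M=-d$,
    where [sp_sum_balanced_even] knows the sum. *)
Lemma sp_sum_even_product n d M (x : 'I_n -> F) :
  (d.*2 <= K)%N -> (forall j, 1 < x j) -> injective x ->
  sp_sum M d.*2.+1 x * sp_numerator x (fun i => i.+1%:Z) =
  (\sum_(p < n.+1) t ^+ p * sp_numerator x (fun i => (d + lift p i)%N%:Z)) *
  sp_numerator x (fun i => M + 1 + (d + i)%N%:Z).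
Proof.
move=> dK x1 inj; have [G hG] := sp_sum_even dK x1 inj.
rewrite -sp_sum_balanced_even // !hG mulrAC; congr (_ * _ * _).
by apply: eq_sp_numerator => i; lia.
Qed.

(** The factor independent of [M] in [sp_sum_odd] is read off at $M=-d-1$.
    There all summands with $p>0$ contain a zero row. *)
Lemma sp_sum_odd_product n d M (x : 'I_n -> F) :
  (d.*2.+1 <= K)%N -> (forall j, 1 < x j) -> injective x ->
  sp_sum M d.*2.+2 x * sp_numerator x (fun i => i.+1%:Z) =
  sp_numerator x (fun i => (d.+1 + i)%N%:Z) *
  \sum_(p < n.+1) t ^+ (n - p) * sp_numerator x (fun i => M + 1 + (d + lift p i)%N%:Z).
Proof.
move=> dK x1 inj; have [G hG] := sp_sum_odd dK x1 inj.
have tn0 : t ^+ n != 0 by rewrite expf_neq0 // gt_eqF.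
have hB : sp_numerator x (fun i => (d.+1 + i)%N%:Z) = G * sp_numerator x (fun i => i.+1%:Z).
  apply: (mulfI tn0); rewrite -sp_sum_balanced_odd // hG big_ord_recl big1 ?addr0 => [|p _].
    rewrite subn0 mulrCA; congr (_ * (_ * _)).
    by apply: eq_sp_numerator => i; rewrite /= /bump /=; lia.
  case: n x x1 inj {hG tn0} p => [|n] x x1 inj p; first by case: p.
  by rewrite (@sp_numerator_eq0 _ x _ ord0) ?mulr0 //= /bump /=; lia.
by rewrite hG hB mulrAC.
Qed.

End Characters.

(** * From characters to dimensions *)

Lemma poly_eq_on_gt (a : nat) (p q : {poly rat}) :
  (forall x, a%:R < x -> p.[x] = q.[x]) -> p = q.
Proof.
move=> h; apply/eqP; rewrite -subr_eq0; apply/eqP; apply: contraTeq isT => nz.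
pose rs : seq rat := [seq (a + k.+1)%N%:R | k <- iota 0 (size (p - q))].
have : (size rs < size (p - q)%R)%N.
  apply: max_poly_roots => //.
    apply/allP => x /mapP[k _ ->]; rewrite /root hornerD hornerN h ?subrr //.
    by rewrite ltr_nat addnS ltnS leq_addr.
  rewrite map_inj_uniq ?iota_uniq // => k k' /eqP.
  by rewrite eqr_nat eqn_add2l eqSS => /eqP.
by rewrite size_map size_iota ltnn.
Qed.

(** Up to a power of $q$ in the denominator, [f] is $(q-1)^k$ times a
    polynomial with value [v] at $q=1$. This replaces the limit of
    $f(q)/(q-1)^k$ for $q\to1$; that [v] is unique is an identity of
    polynomials ([germ_unique]). *)
Definition germ (k : nat) (f : rat -> rat) (v : rat) : Prop :=
  exists (p : {poly rat}) (m : nat),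
    (forall q, 1 < q -> q ^+ m * f q = (q - 1) ^+ k * p.[q]) /\ p.[1] = v.

Lemma germ_unique k f g v w : (forall q, 1 < q -> f q = g q) ->
  germ k f v -> germ k g w -> v = w.
Proof.
move=> fg [p [m [hp <-]]] [p' [m' [hp' <-]]].
suff e : 'X^m' * p = 'X^m * p'.
  by have := congr1 (fun r : {poly rat} => r.[1]) e; rewrite !hornerM !hornerXn !expr1n !mul1r.
apply: (@poly_eq_on_gt 1) => q q1; rewrite !hornerM !hornerXn.
have qk : (q - 1) ^+ k != 0 by rewrite expf_neq0 // subr_eq0 gt_eqF.
by apply: (mulfI qk); rewrite mulrCA -hp // mulrCA [RHS]mulrCA -hp' // fg //.
Qed.

Lemma germ_ext k f g v : (forall q, 1 < q -> f q = g q) -> germ k f v -> germ k g v.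
Proof. by move=> fg [p [m [hp pv]]]; exists p, m; split=> // q q1; rewrite -fg // hp. Qed.

Lemma germM k k' f g v w : germ k f v -> germ k' g w ->
  germ (k + k') (fun q => f q * g q) (v * w).
Proof.
move=> [p [m [hp <-]]] [p' [m' [hp' <-]]]; exists (p * p'), (m + m')%N.
split=> [q q1|]; last by rewrite hornerM.
by rewrite hornerM !exprD mulrACA hp // hp' // mulrACA.
Qed.

Lemma germD k f g v w : germ k f v -> germ k g w -> germ k (fun q => f q + g q) (v + w).
Proof.
move=> [p [m [hp <-]]] [p' [m' [hp' <-]]]; exists ('X^m' * p + 'X^m * p'), (m + m')%N.
split=> [q q1|]; last by rewrite !hornerE !expr1n !mul1r.
rewrite hornerD !hornerM !hornerXn mulrDr [in RHS]mulrDr exprD.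
rewrite ![(q - 1) ^+ k * (_ * _)]mulrCA -hp // -hp' //; ring.
Qed.

Lemma germZ k f v c : germ k f v -> germ k (fun q => c * f q) (c * v).
Proof.
move=> [p [m [hp <-]]]; exists (c *: p), m; split=> [q q1|]; last by rewrite hornerZ.
by rewrite hornerZ mulrCA hp // mulrCA.
Qed.

Lemma germ_sum (I : finType) (P : pred I) k (f : I -> rat -> rat) (v : I -> rat) :
  (forall i, germ k (f i) (v i)) ->
  germ k (fun q => \sum_(i | P i) f i q) (\sum_(i | P i) v i).
Proof.
move=> h; elim: (index_enum I) => [|i r IHr].
  apply: (@germ_ext _ (fun=> 0)) => [q _|]; rewrite ?big_nil //.
  by exists 0, 0%N; split=> [q _|]; rewrite horner0 ?mulr0.
have [v' f'] : germ k (fun q => \sum_(j <- i :: r | P j) f j q) (\sum_(j <- i :: r | P j) v j).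
  rewrite big_cons; apply: (@germ_ext _ (fun q => if P i then f i q + \sum_(j <- r | P j) f j q
     else \sum_(j <- r | P j) f j q)) => [q _|]; first by rewrite big_cons.
  by case: (P i) => //; apply: germD.
by exists v'.
Qed.

Lemma germ_prod (I : finType) (P : pred I) (k : I -> nat) (f : I -> rat -> rat) (v : I -> rat) :
  (forall i, germ (k i) (f i) (v i)) ->
  germ (\sum_(i | P i) k i) (fun q => \prod_(i | P i) f i q) (\prod_(i | P i) v i).
Proof.
move=> h; elim: (index_enum I) => [|i r IHr].
  rewrite !big_nil; apply: (@germ_ext _ (fun=> 1)) => [q _|]; first by rewrite big_nil.
  by exists 1, 0%N; split=> [q _|]; rewrite hornerC ?expr0 ?mulr1.
rewrite !big_cons; apply: (@germ_ext _ (fun q => if P i then f i q * \prod_(j <- r | P j) f j q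
     else \prod_(j <- r | P j) f j q)) => [q _|]; first by rewrite big_cons.
by case: (P i) => //; apply: germM.
Qed.

Lemma germ_pow_diff a b : germ 1 (fun q => q ^+ a - q ^+ b) (a%:R - b%:R).
Proof.
exists (\sum_(i < a) 'X^i - \sum_(i < b) 'X^i), 0%N; split=> [q _|].
  have -> : q ^+ a - q ^+ b = (q ^+ a - 1) - (q ^+ b - 1) by ring.
  rewrite !subrX1 expr0 mul1r expr1 hornerD hornerN !horner_sum mulrBr.
  by congr (_ * _ - _ * _); apply: eq_bigr => i _; rewrite hornerXn.
rewrite hornerD hornerN !horner_sum; congr (_ - _).
  by rewrite -[a in RHS]card_ord -sum1_card natr_sum; apply: eq_bigr => i _; rewrite hornerXn expr1n.
by rewrite -[b in RHS]card_ord -sum1_card natr_sum; apply: eq_bigr => i _; rewrite hornerXn expr1n.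
Qed.

Lemma germ_div_pow k f v m : germ k f v -> germ k (fun q => f q / q ^+ m) v.
Proof.
move=> [p [m' [hp <-]]]; exists p, (m' + m)%N; split=> // q q1.
have qm : q ^+ m != 0 by rewrite expf_neq0 // gt_eqF // (lt_trans ltr01).
by rewrite -hp // exprD; field.
Qed.

(** The Chebyshev polynomials $U_n$ in the normalization
    $(z-z^{-1})\,U_n(z+z^{-1})=z^{n+1}-z^{-n-1}$, together with $U_{n-1}$ for
    the recursion. *)
Fixpoint chebU (n : nat) : {poly rat} * {poly rat} :=
  if n is n'.+1 then ('X * (chebU n').1 - (chebU n').2, (chebU n').1) else (1, 0).

Lemma chebU_monic n : ((chebU n).1 \is monic /\ size (chebU n).1 = n.+1) /\
  (size (chebU n).2 <= n)%N.
Proof.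
elim: n => [|n [[m s] s2]] /=; first by rewrite monic1 size_poly1 size_poly0.
have sX : size ('X * (chebU n).1) = n.+2.
  by rewrite mulrC size_mulX ?s // monic_neq0.
have lt : (size (- (chebU n).2) < size ('X * (chebU n).1)%R)%N.
  by rewrite size_polyN sX; apply: leq_ltn_trans s2 _; rewrite ltnW.
split; last by rewrite s.
rewrite size_polyDl // sX; split=> //.
by rewrite monicE lead_coefDl // -monicE monicMl ?monicX.
Qed.

Lemma chebU_eval n (z : rat) : z != 0 ->
  (z - z^-1) * (chebU n).1.[z + z^-1] = z ^+ n.+1 - z^-1 ^+ n.+1 /\
  (z - z^-1) * (chebU n).2.[z + z^-1] = z ^+ n - z^-1 ^+ n.
Proof.
move=> z0; elim: n => [|n [h1 h2]] /=; first by rewrite !hornerE.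
split; last by [].
rewrite hornerD hornerN hornerM hornerX mulrBr mulrCA h1 h2.
by rewrite !exprS !exprVn; field; rewrite ?z0 ?expf_neq0.
Qed.

Definition geom n (q : rat) (j : 'I_n) : rat := q ^+ j.+1.

(** For $x_j=q^{j+1}$ the entry in row [i] is, up to a factor depending only
    on [i], a Chebyshev polynomial of degree [j] in $q^{l_i}+q^{-l_i}$, so the
    determinant is a Vandermonde determinant. *)
Lemma sp_numerator_geom n (L : 'I_n -> nat) (q : rat) : 1 < q ->
  sp_numerator (@geom n q) (fun i => (L i)%:Z) =
  (\prod_i (q ^+ L i - (q ^+ L i)^-1)) *
  \prod_(i < n) \prod_(j < n | (i < j)%N)
    ((q ^+ L j + (q ^+ L j)^-1) - (q ^+ L i + (q ^+ L i)^-1)).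
Proof.
move=> q1; have q0 : q != 0 by rewrite gt_eqF // (lt_trans ltr01).
rewrite -(@det_monic_polys _ _ (fun j => (chebU j).1) (fun i => q ^+ L i + (q ^+ L i)^-1)); last first.
  by move=> j; have [] := chebU_monic j.
transitivity (\det (\matrix_(i, j) ((q ^+ L i - (q ^+ L i)^-1) * 1 *
   (chebU (j : 'I_n)).1.[q ^+ L i + (q ^+ L i)^-1]))).
  congr (\det _); apply/matrixP => i j; rewrite !mxE mulr1.
  have [-> _] := chebU_eval j (expf_neq0 (L i) q0).
  rewrite /odd_pow /geom -exprnP -exprnN !exprVn -!exprM; congr (q ^+ _ - (q ^+ _)^-1); exact: mulnC.
by rewrite (det_scale (fun i => q ^+ L i - (q ^+ L i)^-1) (fun=> 1)) [\prod_(j < _) 1]big1 // mulr1.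
Qed.

(** The numerator of the Weyl dimension formula for Sp(2n). *)
Definition sp_prod n (L : 'I_n -> nat) : rat :=
  (\prod_i (L i)%:R) *
  \prod_(i < n) \prod_(j < n | (i < j)%N) ((L j)%:R ^+ 2 - (L i)%:R ^+ 2).

Lemma eq_sp_prod n (L L' : 'I_n -> nat) : L =1 L' -> sp_prod L = sp_prod L'.
Proof.
move=> e; congr (_ * _); first by apply: eq_bigr => i _; rewrite e.
by apply: eq_bigr => i _; apply: eq_bigr => j _; rewrite !e.
Qed.

(** The order [k] of vanishing at $q=1$ is the number of positive roots and
    does not depend on the weight, so identities between numerators pass to
    their leading coefficients. *)
Lemma germ_sp_numerator n : exists k, forall L : 'I_n -> nat,
  germ k (fun q => sp_numerator (@geom n q) (fun i => (L i)%:Z)) (2 ^+ n * sp_prod L).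
Proof.
exists (\sum_(i < n) 1 + \sum_(i < n) \sum_(j < n | (i < j)%N) (1 + 1))%N => L.
apply: germ_ext (fun q q1 => esym (sp_numerator_geom L q1)) _.
have e : 2 ^+ n * \prod_i (L i)%:R = \prod_i (2 * (L i)%:R) :> rat.
  by rewrite big_split prodr_const card_ord.
rewrite /sp_prod mulrA e.
apply: germM; apply: germ_prod => i.
  have h := germ_div_pow (L i) (germ_pow_diff (L i + L i) 0).
  apply: germ_ext (_ : germ 1 _ _) => [q q1|]; last first.
    by have -> : 2 * (L i)%:R = (L i + L i)%:R - 0%:R :> rat; [rewrite natrD; ring|exact: h].
  have qm : q ^+ L i != 0 by rewrite expf_neq0 // gt_eqF // (lt_trans ltr01).
  by rewrite /= exprD expr0; field.
apply: germ_prod => j.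
have h := germ_div_pow (L i + L j) (germM (germ_pow_diff (L i + L j) 0) (germ_pow_diff (L j) (L i))).
apply: germ_ext (_ : germ (1 + 1) _ _) => [q q1|]; last first.
  have -> : (L j)%:R ^+ 2 - (L i)%:R ^+ 2 =
     ((L i + L j)%:R - 0%:R) * ((L j)%:R - (L i)%:R) :> rat by rewrite natrD; ring.
  exact: h.
have qm m : q ^+ m != 0 by rewrite expf_neq0 // gt_eqF // (lt_trans ltr01).
by rewrite /= exprD expr0; field; rewrite !qm.
Qed.

Lemma geom_gt1 n q : 1 < q -> forall j : 'I_n, 1 < geom q j.
Proof. by move=> q1 j; rewrite /geom exprn_egt1. Qed.

Lemma geom_inj n q : 1 < q -> injective (@geom n q).
Proof.
move=> q1 i j /ieexprIn e; apply/ord_inj/succn_inj/e; first exact: lt_trans q1.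
by rewrite gt_eqF.
Qed.

Definition sp_prod_sum (t : rat) K n M c : rat :=
  \sum_(lam : {ffun 'I_n -> 'I_K.+1} |
      mono_fun (fun i => lam i) && bounded_fun c (fun i => lam i))
    parity_weight t (fun i => lam i) * sp_prod (fun i => M + lam i + i.+1)%N.

Lemma germ_sp_sum (t : rat) K n M c k :
  (forall L : 'I_n -> nat,
    germ k (fun q => sp_numerator (@geom n q) (fun i => (L i)%:Z)) (2 ^+ n * sp_prod L)) ->
  germ k (fun q => sp_sum t K M%:Z c (@geom n q)) (2 ^+ n * sp_prod_sum t K n M c).
Proof.
move=> hk; rewrite /sp_prod_sum mulr_sumr; apply: germ_sum => lam.
rewrite mulrCA; apply: germZ; apply: germ_ext (hk _) => q _.
by apply: eq_sp_numerator => i; lia.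
Qed.

Lemma sp_prod_sum_even (t : rat) K n d M : 0 < t -> (d.*2 <= K)%N ->
  sp_prod_sum t K n M d.*2.+1 * sp_prod (fun i : 'I_n => i.+1) =
  (\sum_(p < n.+1) t ^+ p * sp_prod (fun i => d + lift p i)%N) *
  sp_prod (fun i : 'I_n => M + d + i.+1)%N.
Proof.
move=> t0 dK; have [k hk] := germ_sp_numerator n.
have two : (2 : rat) ^+ n != 0 by rewrite expf_neq0.
apply: (mulfI two); apply: (mulfI two).
have hR : germ k (fun q => sp_numerator (@geom n q) (fun i => M%:Z + 1 + (d + i)%N%:Z))
    (2 ^+ n * sp_prod (fun i : 'I_n => M + d + i.+1)%N).
  by apply: germ_ext (hk _) => q _; apply: eq_sp_numerator => i; lia.
have := germ_unique (fun q q1 => sp_sum_even_product t0 M%:Z dK (geom_gt1 q1) (@geom_inj n q q1))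
  (germM (germ_sp_sum t K M d.*2.+1 hk) (hk (fun i => i.+1)))
  (germM (germ_sum xpredT (fun p : 'I_n.+1 => germZ (t ^+ p) (hk (fun i => d + lift p i)%N))) hR).
move=> e; transitivity (2 ^+ n * sp_prod_sum t K n M d.*2.+1 * (2 ^+ n * sp_prod (fun i : 'I_n => i.+1))).
  by ring.
rewrite e; under eq_bigr do rewrite mulrCA.
by rewrite -mulr_sumr; ring.
Qed.

Lemma sp_prod_sum_odd (t : rat) K n d M : 0 < t -> (d.*2.+1 <= K)%N ->
  sp_prod_sum t K n M d.*2.+2 * sp_prod (fun i : 'I_n => i.+1) =
  sp_prod (fun i : 'I_n => d + i.+1)%N *
  \sum_(p < n.+1) t ^+ (n - p) * sp_prod (fun i => M + d + (lift p i).+1)%N.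
Proof.
move=> t0 dK; have [k hk] := germ_sp_numerator n.
have two : (2 : rat) ^+ n != 0 by rewrite expf_neq0.
apply: (mulfI two); apply: (mulfI two).
have hR (p : 'I_n.+1) :
    germ k (fun q => sp_numerator (@geom n q) (fun i => M%:Z + 1 + (d + lift p i)%N%:Z))
    (2 ^+ n * sp_prod (fun i : 'I_n => M + d + (lift p i).+1)%N).
  by apply: germ_ext (hk _) => q _; apply: eq_sp_numerator => i; lia.
have hL : germ k (fun q => sp_numerator (@geom n q) (fun i => (d.+1 + i)%N%:Z))
    (2 ^+ n * sp_prod (fun i : 'I_n => d + i.+1)%N).
  by apply: germ_ext (hk _) => q _; apply: eq_sp_numerator => i; lia.
have := germ_unique (fun q q1 => sp_sum_odd_product t0 M%:Z dK (geom_gt1 q1) (@geom_inj n q q1))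
  (germM (germ_sp_sum t K M d.*2.+2 hk) (hk (fun i => i.+1)))
  (germM hL (germ_sum xpredT (fun p : 'I_n.+1 => germZ (t ^+ (n - p)) (hR p)))).
move=> e; transitivity (2 ^+ n * sp_prod_sum t K n M d.*2.+2 * (2 ^+ n * sp_prod (fun i : 'I_n => i.+1))).
  by ring.
rewrite e; under eq_bigr do rewrite mulrCA.
by rewrite -mulr_sumr; ring.
Qed.

(** * Evaluation of the products *)

(** The polynomial in $l^2$ with zeros at the squares of $1,\dots,j$; times
    $l$ it is the falling factorial $(l+j)(l+j-1)\cdots(l-j)$. *)
Definition centered_poly (j : nat) : {poly rat} := \prod_(m < j) ('X - (m.+1%:R ^+ 2)%:P).

Lemma centered_polyE (l j : nat) :
  l%:R * (centered_poly j).[l%:R ^+ 2] = ((2 * j + 1)`!)%:R * 'C(l + j, 2 * j + 1)%:R :> rat.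
Proof.
rewrite -natrM mulnC bin_ffact; elim: j => [|j IHj].
  by rewrite /centered_poly big_ord0 hornerC mulr1 addn0 ffactn1.
rewrite /centered_poly big_ord_recr /= hornerM mulrA IHj.
have -> : ((l + j.+1) ^_ (2 * j.+1 + 1) = (l + j.+1) * ((l + j) ^_ (2 * j + 1) * (l - j.+1)))%N.
  rewrite (_ : 2 * j.+1 + 1 = (2 * j + 1).+2)%N; last by lia.
  by rewrite addnS ffactSS ffactnSr; congr (_ * (_ * _))%N; lia.
case: (leqP l j) => lj.
  by rewrite ffact_small ?mul0n ?muln0 ?mul0r //; lia.
by rewrite !hornerE !natrM natrB // natrD; ring.
Qed.

Lemma det_bin_sp_prod n (l : 'I_n -> nat) :
  (\prod_(j < n) ((2 * j + 1)`!)%:R) * \det (\matrix_(i, j) 'C(l i + j, 2 * j + 1)%:R) =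
  sp_prod l.
Proof.
transitivity (\det (\matrix_(i, j) ((l i)%:R * 1 * (centered_poly (j : 'I_n)).[(l i)%:R ^+ 2]))).
  transitivity (\det (\matrix_(i < n, j < n) (1 * ((2 * j + 1)`!)%:R * 'C(l i + j, 2 * j + 1)%:R : rat))).
    rewrite (det_scale (fun=> 1) (fun j : 'I_n => ((2 * j + 1)`!)%:R) (fun i j => 'C(l i + j, 2 * j + 1)%:R)).
    by rewrite [X in _ = X * _ * _]big1 // mul1r.
  by congr (\det _); apply/matrixP => i j; rewrite !mxE mulr1 mul1r centered_polyE.
rewrite (det_scale (fun i => (l i)%:R) (fun=> 1) (fun i j => (centered_poly (j : 'I_n)).[(l i)%:R ^+ 2])).
rewrite [\prod_(j < _) 1]big1 // mulr1 /sp_prod; congr (_ * _).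
rewrite (@det_monic_polys _ _ (fun j => centered_poly j) (fun i => (l i)%:R ^+ 2)) // => j.
by rewrite /centered_poly monic_prod_XsubC size_prod_XsubC /index_enum -enumT size_enum_ord.
Qed.

(** The matrix of binomial coefficients at $l_i=i+1$ is unitriangular. *)
Lemma sp_prod_rho n :
  sp_prod (fun i : 'I_n => i.+1) = \prod_(j < n) ((2 * j + 1)`!)%:R.
Proof.
rewrite -det_bin_sp_prod det_trig.
  rewrite [X in _ * X]big1 ?mulr1 // => i _; rewrite mxE (_ : (i.+1 + i = 2 * i + 1)%N) ?binn //.
  by lia.
by apply/is_trig_mxP => i j ij; rewrite mxE bin_small //; lia.
Qed.

Lemma sp_prod_rho_neq0 n : sp_prod (fun i : 'I_n => i.+1) != 0.
Proof.
by rewrite sp_prod_rho; apply/prodf_neq0 => j _; rewrite pnatr_eq0 -lt0n fact_gt0.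
Qed.

Lemma sp_det_prod n (lam : 'I_n -> nat) :
  sp_det lam * sp_prod (fun i : 'I_n => i.+1) = sp_prod (fun i => lam i + i.+1)%N.
Proof.
rewrite sp_prod_rho mulrC -det_bin_sp_prod; congr (_ * \det _).
by apply/matrixP => i j; rewrite !mxE; congr 'C(_, _)%:R; lia.
Qed.

Definition tri_prod n (G : nat -> nat -> rat) : rat :=
  \prod_(1 <= i < n.+1) \prod_(i <= j < n.+1) G i j.

Lemma tri_prod_ord n G :
  tri_prod n G = \prod_(i < n) \prod_(j < n | (i <= j)%N) G i.+1 j.+1.
Proof.
rewrite /tri_prod big_add1 big_mkord; apply: eq_bigr => i _.
by rewrite big_add1 /= (big_nat_widenl _ 0) // big_mkord.
Qed.

Lemma tri_prodM n G H : tri_prod n (fun i j => G i j * H i j) = tri_prod n G * tri_prod n H.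
Proof.
by rewrite /tri_prod -big_split; apply: eq_bigr => i _; rewrite -big_split.
Qed.

(** The factors split as $(l_j-l_i)(l_j+l_i)$; the differences are independent
    of [m], and the factors $l_i$ supply the sums with $i=j$, up to powers of
    2. *)
Lemma sp_prod_rect_aux n m :
  2 ^+ n * sp_prod (fun i : 'I_n => m + i.+1)%N =
  (\prod_(i < n) \prod_(j < n | (i < j)%N) (j%:R - i%:R)) *
  tri_prod n (fun i j => (2 * m)%N%:R + i%:R + j%:R).
Proof.
rewrite tri_prod_ord.
have -> : \prod_(i < n) \prod_(j < n | (i <= j)%N) ((2 * m)%N%:R + i.+1%:R + j.+1%:R) =
    (\prod_(i < n) (2 * (m + i.+1)%N%:R)) *
    \prod_(i < n) \prod_(j < n | (i < j)%N) ((2 * m)%N%:R + i.+1%:R + j.+1%:R) :> rat.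
  rewrite -big_split /=; apply: eq_bigr => i _; rewrite (bigD1 i) //=; congr (_ * _).
    by rewrite natrD natrM; ring.
  by apply: eq_bigl => j; rewrite ltn_neqAle andbC eq_sym.
have key : \prod_(i < n) \prod_(j < n | (i < j)%N)
      ((m + j.+1)%N%:R ^+ 2 - (m + i.+1)%N%:R ^+ 2) =
    (\prod_(i < n) \prod_(j < n | (i < j)%N) (j%:R - i%:R)) *
    \prod_(i < n) \prod_(j < n | (i < j)%N) ((2 * m)%N%:R + i.+1%:R + j.+1%:R) :> rat.
  rewrite -big_split; apply: eq_bigr => i _ /=; rewrite -big_split; apply: eq_bigr => j _ /=.
  by rewrite natrM !natrD -!natr1; ring.
by rewrite big_split prodr_const card_ord /= /sp_prod key; ring.
Qed.

Lemma sp_prod_rect n m :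
  sp_prod (fun i : 'I_n => m + i.+1)%N / sp_prod (fun i : 'I_n => i.+1) =
  tri_prod n (fun i j => ((2 * m)%N%:R + i%:R + j%:R) / (i%:R + j%:R)).
Proof.
have two : (2 : rat) ^+ n != 0 by rewrite expf_neq0.
have h0 := sp_prod_rect_aux n 0; rewrite muln0 in h0.
have hm := sp_prod_rect_aux n m.
have e : tri_prod n (fun i j => 0%:R + i%:R + j%:R) = tri_prod n (fun i j => i%:R + j%:R).
  by do 2!(apply: eq_bigr => ? _); rewrite add0r.
rewrite e {e} in h0.
have nz := sp_prod_rho_neq0 n.
have : tri_prod n (fun i j => (2 * m)%N%:R + i%:R + j%:R) =
  tri_prod n (fun i j => ((2 * m)%N%:R + i%:R + j%:R) / (i%:R + j%:R)) * tri_prod n (fun i j => i%:R + j%:R).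
  rewrite -tri_prodM; rewrite /tri_prod !big_nat; apply: eq_bigr => i /andP[i1 _].
  apply: eq_bigr => j _; rewrite divfK // -natrD pnatr_eq0; lia.
move=> e; rewrite e [RHS]mulrCA -h0 in hm.
by apply: (mulfI two); apply: (mulIf nz); rewrite -mulrA divfK // hm; ring.
Qed.

Lemma ltn_lift n (p : 'I_n.+1) (i j : 'I_n) : (lift p i < lift p j)%N = (i < j)%N.
Proof. by rewrite /= !ltnNge leq_bump2. Qed.

(** The factors that involve the entry at index [p] are collected. *)
Lemma sp_prod_lift n (L : 'I_n.+1 -> nat) (p : 'I_n.+1) :
  sp_prod L = sp_prod (fun i => L (lift p i)) * (L p)%:R *
   \prod_(k < n) (if (k < p)%N then (L p)%:R ^+ 2 - (L (lift p k))%:R ^+ 2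
                  else (L (lift p k))%:R ^+ 2 - (L p)%:R ^+ 2).
Proof.
pose A (i j : 'I_n.+1) : rat := (L j)%:R ^+ 2 - (L i)%:R ^+ 2.
rewrite /sp_prod (bigD1_ord p) //=.
have -> : \prod_(i < n.+1) \prod_(j < n.+1 | (i < j)%N) A i j =
   (\prod_(i < n) \prod_(j < n | (i < j)%N) A (lift p i) (lift p j)) *
   \prod_(k < n) (if (k < p)%N then A (lift p k) p else A p (lift p k)).
  rewrite (bigD1_ord p) //=.
  have -> : \prod_(j < n.+1 | (p < j)%N) A p j =
      \prod_(k < n) (if (k < p)%N then 1 else A p (lift p k)).
    rewrite big_mkcond (bigD1_ord p) //= ltnn mul1r; apply: eq_bigr => k _.
    by rewrite /bump; case: (ltnP k p) => kp; rewrite ?add0n ?add1n ?ltnS ?kp // ltnNge ltnW.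
  rewrite mulrC.
  have -> : \prod_(i < n) \prod_(j < n.+1 | (lift p i < j)%N) A (lift p i) j =
     (\prod_(k < n) (if (k < p)%N then A (lift p k) p else 1)) *
     \prod_(i < n) \prod_(j < n | (i < j)%N) A (lift p i) (lift p j).
    rewrite -big_split; apply: eq_bigr => i _ /=; rewrite big_mkcond (bigD1_ord p) //=.
    congr (_ * _).
      by rewrite /bump; case: (ltnP i p) => ip; rewrite ?add0n ?add1n ?ip // ltnNge leqW.
    by rewrite [RHS]big_mkcond; apply: eq_bigr => j _; rewrite -(ltn_lift p).
  rewrite mulrAC mulrC; congr (_ * _); rewrite -big_split; apply: eq_bigr => k _ /=.
  by case: ifP; rewrite ?mulr1 ?mul1r.
by rewrite -/A; ring.
Qed.

Lemma prod_rising (a n : nat) :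
  \prod_(k < n.+1) (a + k)%N%:R = (n.+1`!)%:R * 'C(a + n, n.+1)%:R :> rat.
Proof.
rewrite -natrM mulnC bin_ffact ffact_prod -natr_prod; congr (_%:R).
by rewrite (reindex_inj rev_ord_inj) /=; apply: eq_bigr => k _; have := ltn_ord k; lia.
Qed.

Lemma prod_gaps (n p : nat) : (p <= n)%N ->
  \prod_(k < n) (if (k < p)%N then (p - k)%N else (k.+1 - p)%N)%:R = (p`! * (n - p)`!)%N%:R :> rat.
Proof.
move=> pn; rewrite -natr_prod; congr (_%:R).
rewrite -(big_mkord xpredT (fun k => if (k < p)%N then (p - k)%N else (k.+1 - p)%N)).
rewrite (@big_cat_nat _ _ _ p) //=; congr (_ * _)%N.
  rewrite -ffactnn ffact_prod big_mkord; apply: eq_bigr => k _; by rewrite ltn_ord.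
rewrite -{1}[p]add0n big_addn fact_prod big_add1 /= !big_nat; apply: eq_bigr => k _.
by rewrite ltnNge leq_addl /=; lia.
Qed.

(** The left side does not depend on the omitted index [p]; comparing it with
    $p=0$ evaluates the product with one value omitted. The factor 2 turns
    $d+p$ into the missing sum $2d+2p$. *)
Lemma sp_prod_delete_aux n d (p : 'I_n.+1) :
  2 * sp_prod (fun i : 'I_n.+1 => d + i)%N =
  sp_prod (fun i => d + lift p i)%N * (p`! * (n - p)`!)%N%:R *
  ((n.+1`!)%:R * 'C(2 * d + p + n, n.+1)%:R).
Proof.
rewrite (sp_prod_lift _ p) -prod_rising -(@prod_gaps n p) -1?ltnS //.
rewrite [\prod_(k < n.+1) _](bigD1_ord p) //=.
have -> : \prod_(k < n) (if (k < p)%N then (d + p)%N%:R ^+ 2 - (d + bump p k)%N%:R ^+ 2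
                 else (d + bump p k)%N%:R ^+ 2 - (d + p)%N%:R ^+ 2) =
    (\prod_(k < n) (if (k < p)%N then (p - k)%N else (k.+1 - p)%N)%:R) *
    \prod_(k < n) (2 * d + p + bump p k)%N%:R :> rat.
  rewrite -big_split; apply: eq_bigr => k _ /=; rewrite /bump.
  case: (ltnP k p) => kp; rewrite ?add0n ?add1n.
    by rewrite natrB ?(ltnW kp) // mul2n -addnn !natrD; ring.
  by rewrite natrB ?leqW // mul2n -addnn !natrD -!natr1; ring.
by rewrite mul2n -addnn !natrD; ring.
Qed.

Lemma sp_prod_delete n d (p : 'I_n.+1) :
  sp_prod (fun i => d + lift p i)%N =
  'C(n, p)%:R * binom_quotient (2 * d + n) p n.+1 * sp_prod (fun i : 'I_n => d + i.+1)%N.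
Proof.
have e0 : sp_prod (fun i => d + lift (@ord0 n) i)%N = sp_prod (fun i : 'I_n => d + i.+1)%N by [].
have [->|p0] := eqVneq p ord0; first by rewrite bin0 /binom_quotient eqxx !mul1r.
have hp := sp_prod_delete_aux d p; rewrite (sp_prod_delete_aux d ord0) in hp.
rewrite /binom_quotient ifN; last by apply: contra p0 => /eqP h; apply/eqP/ord_inj.
have C0 : 'C(2 * d + p + n, n.+1)%:R != 0 :> rat.
  rewrite pnatr_eq0 -lt0n bin_gt0; have : (p != 0 :> nat) by apply: contra p0 => /eqP h; apply/eqP/ord_inj.
  by lia.
have pn : (p <= n)%N by rewrite -ltnS.
have f0 m : (m`!)%:R != 0 :> rat by rewrite pnatr_eq0 -lt0n fact_gt0.
rewrite /= fact0 mul1n subn0 addn0 -(bin_fact pn) (natrM _ 'C(n, p)) (natrM _ p`!) in hp.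
rewrite (_ : 2 * d + n + p = 2 * d + p + n)%N; last by lia.
have k0 : (p`!)%:R * ((n - p)`!)%:R * (n.+1`!)%:R != 0 :> rat by rewrite !mulf_neq0.
apply: (mulIf C0); apply: (mulIf k0).
transitivity (sp_prod (fun i => d + lift p i)%N * ((p`!)%:R * ((n - p)`!)%:R) *
     ((n.+1)`!%:R * 'C(2 * d + p + n, n.+1)%:R)); first by ring.
rewrite -hp e0; by field.
Qed.

Lemma sum_bin_shift n (f : nat -> rat) :
  \sum_(p < n.+2) 'C(n.+1, p)%:R * f p = \sum_(p < n.+1) 'C(n, p)%:R * (f p + f p.+1).
Proof.
have e : \sum_(p < n.+1) 'C(n, p)%:R * f p = f 0%N + \sum_(p < n.+1) 'C(n, p.+1)%:R * f p.+1.
  transitivity (\sum_(p < n.+2) 'C(n, p)%:R * f p).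
    by rewrite [RHS]big_ord_recr /= bin_small // mul0r addr0.
  by rewrite big_ord_recl bin0 mul1r.
under [RHS]eq_bigr do rewrite mulrDr.
rewrite [RHS]big_split /= e big_ord_recl bin0 mul1r -addrA; congr (_ + _).
by rewrite -big_split /=; apply: eq_bigr => p _; rewrite /bump add1n binS natrD mulrDl.
Qed.

(** The two products share all factors but the first of one and the last of
    the other, which differ by $s(m+1)$. *)
Lemma inv_rising_diff (s x : rat) m : 0 < x -> 0 < s ->
  (\prod_(k < m.+1) (x + s * k%:R))^-1 - (\prod_(k < m.+1) (x + s + s * k%:R))^-1 =
  s * m.+1%:R / \prod_(k < m.+2) (x + s * k%:R).
Proof.
move=> x0 s0.
have pos y j : 0 < y -> \prod_(k < j) (y + s * k%:R) != 0.
  move=> y0; apply/prodf_neq0 => k _; rewrite gt_eqF // ltr_wpDr //.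
  by rewrite mulr_ge0 ?ler0n // ltW.
have A0 := pos x m.+1 x0; have B0 := pos (x + s) m.+1 (addr_gt0 x0 s0).
have PA : \prod_(k < m.+2) (x + s * k%:R) =
    \prod_(k < m.+1) (x + s * k%:R) * (x + s * m.+1%:R) by rewrite big_ord_recr.
have PB : \prod_(k < m.+2) (x + s * k%:R) = x * \prod_(k < m.+1) (x + s + s * k%:R).
  rewrite big_ord_recl mulr0 addr0; congr (_ * _); apply: eq_bigr => k _.
  by rewrite /= /bump add1n -natr1; ring.
rewrite PB in PA; rewrite PB.
have y0 : x + s * m.+1%:R != 0 by rewrite gt_eqF // ltr_wpDr // mulr_ge0 ?ler0n // ltW.
have xn0 : x != 0 by rewrite gt_eqF.
set A := \prod_(k < m.+1) (x + s * k%:R) in A0 PA *.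
set B := \prod_(k < m.+1) (x + s + s * k%:R) in B0 PA *.
have -> : A = x * B / (x + s * m.+1%:R) by rewrite PA mulfK.
by move: (m.+1%:R) y0 => c y0; field; rewrite B0 xn0 y0.
Qed.

(** A terminating case of Kummer's summation. Both sides satisfy
    $(n+1)\,u_{n+1}(a)=u_n(a)-u_n(a+2)$: on the left two steps of
    [inv_rising_diff] with step 1 are joined by [sum_bin_shift], on the right
    one step of length 2 is used. *)
Lemma sum_bin_inv_rising n (a : rat) : 0 < a ->
  \sum_(p < n.+1) 'C(n, p)%:R * (\prod_(k < n.+1) (a + p%:R + 1 * k%:R))^-1 =
  2 ^+ n * (\prod_(k < n.+1) (a + 2 * k%:R))^-1.
Proof.
elim: n a => [|n IHn] a a0.
  by rewrite !big_ord1 /= bin0 expr0 !mul1r !mulr0 !addr0.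
have n0 : (n.+1%:R : rat) != 0 by rewrite pnatr_eq0.
rewrite (sum_bin_shift n (fun p => (\prod_(k < n.+2) (a + p%:R + 1 * k%:R))^-1)).
apply: (mulIf n0); transitivity (
   \sum_(p < n.+1) 'C(n, p)%:R * (\prod_(k < n.+1) (a + p%:R + 1 * k%:R))^-1 -
   \sum_(p < n.+1) 'C(n, p)%:R * (\prod_(k < n.+1) (a + 2 + p%:R + 1 * k%:R))^-1).
  rewrite -sumrB mulr_suml; apply: eq_bigr => p _; rewrite -mulrBr -mulrA; congr (_ * _).
  have pos (m : nat) : 0 < a + m%:R by rewrite ltr_wpDr ?ler0n.
  have h1 := inv_rising_diff n (pos p) ltr01.
  have h2 := inv_rising_diff n (pos p.+1) ltr01.
  have e1 : a + p%:R + 1 = a + p.+1%:R by rewrite -natr1; ring.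
  have e2 : a + p.+1%:R + 1 = a + 2 + p%:R by rewrite -natr1; ring.
  rewrite e1 mul1r in h1; rewrite e2 mul1r in h2.
  rewrite mulrDl ![_^-1 * n.+1%:R]mulrC -h1 -h2; ring.
rewrite IHn // IHn ?addr_gt0 // -mulrBr inv_rising_diff // exprS; ring.
Qed.

(** For $a>0$ the quotients are ratios of rising factorials, and
    [sum_bin_inv_rising] applies. For $a=0$ only $p=0$ contributes, by the
    convention for the quotient. *)
Lemma sum_binom_quotient n a :
  \sum_(p < n.+1) 'C(n, p)%:R * binom_quotient (a + n) p n.+1 =
  2 ^+ n * \prod_(k < n) ((a + k.+1)%N%:R / (a + 2 * k.+1)%N%:R).
Proof.
case: a => [|a].
  rewrite big_ord_recl big1 => [|p _].
    rewrite bin0 /binom_quotient eqxx mulr1 addr0.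
    rewrite -[n in 2 ^+ n]card_ord -prodr_const -big_split big1 // => k _ /=.
    have h : (k.+1%:R : rat) != 0 by rewrite pnatr_eq0.
    by rewrite !add0n natrM; move: (k.+1%:R) h => c h; field.
  by rewrite /binom_quotient add0n (bin_small (ltnSn n)) mul0r [X in _ * X]/= mulr0.
have a0 : (0 : rat) < a.+1%:R by rewrite ltr0n.
have fn0 : ((n.+1)`!%:R : rat) != 0 by rewrite pnatr_eq0 -lt0n fact_gt0.
have C0 p : ('C(a.+1 + p + n, n.+1)%:R : rat) != 0.
  by rewrite pnatr_eq0 -lt0n bin_gt0; lia.
transitivity (\prod_(k < n.+1) (a.+1 + k)%N%:R *
   \sum_(p < n.+1) 'C(n, p)%:R * (\prod_(k < n.+1) (a.+1%:R + p%:R + 1 * k%:R))^-1 : rat).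
  rewrite mulr_sumr; apply: eq_bigr => p _; rewrite mulrCA; congr (_ * _).
  transitivity ('C(a.+1 + n, n.+1)%:R / 'C(a.+1 + p + n, n.+1)%:R : rat).
    rewrite /binom_quotient addnAC; case: eqP => [->|//].
    by rewrite addn0 divff //; have := C0 0%N; rewrite addn0.
  rewrite prod_rising.
  have -> : \prod_(k < n.+1) (a.+1%:R + p%:R + 1 * k%:R) = \prod_(k < n.+1) (a.+1 + p + k)%N%:R :> rat.
    by apply: eq_bigr => k _; rewrite !natrD mul1r.
  by rewrite prod_rising; field; rewrite fn0 C0.
rewrite sum_bin_inv_rising // mulrCA; congr (_ * _).
rewrite !big_ord_recl addn0 mulr0 addr0 -mulf_div divff ?gt_eqF // mul1r.
rewrite -prodfV -big_split; apply: eq_bigr => k _ /=.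
by rewrite /bump !add1n; congr (_ / _); rewrite natrD natrM.
Qed.

Lemma tri_prod_recr n G :
  tri_prod n.+1 G = tri_prod n G * \prod_(1 <= i < n.+2) G i n.+1.
Proof.
rewrite /tri_prod big_nat_recr //= big_nat1 [X in _ = _ * X]big_nat_recr //= mulrA; congr (_ * _).
rewrite -big_split /= !big_nat; apply: eq_bigr => i /andP[_ h].
by rewrite big_nat_recr //= ltnW.
Qed.

Lemma tri_prod_shift n a :
  tri_prod n (fun i j => (a%:R - 1 + i%:R + j%:R) / (a%:R + i%:R + j%:R)) =
  \prod_(k < n) ((a + k.+1)%N%:R / (a + 2 * k.+1)%N%:R).
Proof.
elim: n => [|n IHn]; first by rewrite /tri_prod big_geq ?big_ord0.
rewrite tri_prod_recr big_ord_recr IHn /=; congr (_ * _).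
rewrite (telescope_prodr_eq (fun i => (a + i + n)%N%:R : rat)) //.
- by congr (_%:R / _%:R); lia.
- by move=> k /andP[k1 _]; rewrite unitfE pnatr_eq0; lia.
- by move=> k _; rewrite !natrD -!natr1; congr (_ / _); ring.
Qed.

Lemma count_from_products n p u v (x : rat) : (p <= n)%N ->
  x * sp_prod (fun i : 'I_n => i.+1) ^+ 2 =
    sp_prod (fun i : 'I_n => u + lift (inord p : 'I_n.+1) i)%N *
    sp_prod (fun i : 'I_n => v + i.+1)%N ->
  x = 'C(n, p)%:R * binom_quotient (2 * u + n) p n.+1 *
      tri_prod n (fun i j => ((2 * u)%N%:R + i%:R + j%:R) * ((2 * v)%N%:R + i%:R + j%:R)
                             / (i%:R + j%:R) ^+ 2).
Proof.
move=> pn; have D0 := sp_prod_rho_neq0 n; set D := sp_prod _ in D0 *.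
rewrite sp_prod_delete inordK // => h.
have -> : tri_prod n (fun i j => ((2 * u)%N%:R + i%:R + j%:R) * ((2 * v)%N%:R + i%:R + j%:R)
                             / (i%:R + j%:R) ^+ 2) =
   (sp_prod (fun i : 'I_n => u + i.+1)%N / D) * (sp_prod (fun i : 'I_n => v + i.+1)%N / D).
  rewrite !sp_prod_rect -tri_prodM; do 2!(apply: eq_bigr => ? _).
  by rewrite mulf_div expr2.
have D2 : D ^+ 2 != 0 by rewrite expf_neq0.
by apply: (mulIf D2); rewrite h; field.
Qed.

Lemma sum_counts n u :
  \sum_(p < n.+1) 'C(n, p)%:R * binom_quotient (2 * u + n) p n.+1 *
     tri_prod n (fun i j => ((2 * u)%N%:R + i%:R + j%:R) / (i%:R + j%:R)) =
  2 ^+ n * tri_prod n (fun i j => ((2 * u)%N%:R - 1 + i%:R + j%:R) / (i%:R + j%:R)).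
Proof.
rewrite -mulr_suml sum_binom_quotient -tri_prod_shift -mulrA -tri_prodM; congr (_ * _).
rewrite /tri_prod !big_nat; apply: eq_bigr => i /andP[i1 _]; apply: eq_bigr => j _.
rewrite mulrA divfK // -!natrD pnatr_eq0; lia.
Qed.

(** * Counting by the main diagonal *)

Section DiagonalStatistics.
Variables (n N : nat).
Implicit Types (f : filling n N).

Lemma diag_cell_proof (a : 'I_n) :
  in_trapezoid (rev_ord a, widen_ord (leq_pmull n (isT : 0 < 2)%N) (rev_ord a)).
Proof. by rewrite /in_trapezoid /=; have := ltn_ord a; lia. Qed.

(** Position [a] of the main diagonal counted from below, as in [diag_fun]. *)
Definition diag_cell (a : 'I_n) : cell n := Sub (_, _) (diag_cell_proof a).

Lemma diag_fun_cell f a : diag_fun f a = f (diag_cell a) :> nat.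
Proof. by rewrite diag_funE (@entryE _ _ _ _ _ (diag_cell a)) // /ccol /= addn0. Qed.

Definition diag_index (c : cell n) : 'I_n := rev_ord (val c).1.

Lemma diag_indexK c : on_diagonal c -> diag_cell (diag_index c) = c.
Proof.
move=> /eqP e; have h := congr1 (@nat_of_ord n) (rev_ordK (val c).1).
by apply: cell_inj; [exact: h|rewrite -e; exact: h].
Qed.

Lemma on_diag_cell a : on_diagonal (diag_cell a).
Proof. by rewrite /on_diagonal /crow /ccol /=. Qed.

Lemma card_on_diagonal f (P : pred nat) :
  #|[set c | on_diagonal c && P (f c)]| = (\sum_(a < n) P (diag_fun f a))%N.
Proof.
rewrite -sum1_card (reindex_onto diag_cell diag_index) /=; last first.
  by move=> c; rewrite inE => /andP[/diag_indexK].
rewrite big_mkcond; apply: eq_bigr => a _.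
have -> : diag_index (diag_cell a) = a by exact: rev_ordK.
by rewrite inE on_diag_cell eqxx andbT -diag_fun_cell /=; case: (P _).
Qed.

Lemma diagonal_at_leastE f M :
  diagonal_at_least M f = [forall a, M <= diag_fun f a]%N.
Proof.
apply/forallP/forallP => h => [a|c].
  by rewrite diag_fun_cell; apply: (implyP (h _)); apply: on_diag_cell.
by apply/implyP => dc; have := h (diag_index c); rewrite diag_fun_cell diag_indexK.
Qed.

Lemma mono_diag_fun f : plane_partition f -> mono_fun (fun a => diag_fun f a).
Proof.
move=> /plane_partitionP h; apply/mono_funP => a b ab; rewrite !diag_funE.
have mono i m : (entry f (i + m) 0 <= entry f i 0)%N.
  elim: m => [|m IHm]; first by rewrite addn0.
  rewrite addnS; apply: leq_trans IHm; have [h1 h2] := h (i + m)%N 0%N.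
  exact: leq_trans h2 h1.
have := mono (n - b.+1)%N (b - a)%N.
by rewrite (_ : _ + _ = n - a.+1)%N //; have := ltn_ord b; lia.
Qed.

End DiagonalStatistics.

Definition parity_defect (n N : nat) (lam : 'I_n -> nat) : nat :=
  (\sum_(a < n) (odd (lam a) != odd N))%N.

Lemma weighted_count_diag (t : rat) n N M :
  \sum_(f in trapezoidal_pps n N M) t ^+ diagonal_parity_defect f =
  \sum_(lam : {ffun 'I_n -> 'I_N.+1} |
      mono_fun (fun a => lam a) && [forall a, M <= lam a]%N)
    t ^+ parity_defect N (fun a => lam a) * sp_det (fun a => lam a).
Proof.
rewrite (partition_big (fun f => diag_fun f)
  (fun lam : {ffun 'I_n -> 'I_N.+1} => mono_fun (fun a => lam a) && [forall a, M <= lam a]%N)) /=; last first.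
  by move=> f; rewrite inE diagonal_at_leastE => /andP[/mono_diag_fun -> ->].
apply: eq_bigr => lam /andP[mono_lam lam_M].
rewrite -card_plane_partitions_diag // mulr_natr -sumr_const.
apply: eq_big => [f|f /andP[_ /eqP <-]].
  rewrite !inE diagonal_at_leastE; case: eqP => [->|_]; rewrite ?andbF //.
  by rewrite lam_M andbT.
by rewrite /diagonal_parity_defect (card_on_diagonal f (fun v => odd v != odd N)).
Qed.

(** The main diagonal is shifted down by [M], to range over a box, and
    [sp_det_prod] replaces the determinants by products. *)
Lemma weighted_count_shift (t : rat) n N M : (M <= N)%N ->
  (\sum_(f in trapezoidal_pps n N M) t ^+ diagonal_parity_defect f) *
    sp_prod (fun i : 'I_n => i.+1) =
  \sum_(lam : {ffun 'I_n -> 'I_N.+1} |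
      mono_fun (fun a => lam a) && bounded_fun (N - M).+1 (fun a => lam a))
    t ^+ parity_defect N (fun a => M + lam a)%N * sp_prod (fun a => M + lam a + a.+1)%N.
Proof.
move=> MN; rewrite weighted_count_diag.
pose up (lam : {ffun 'I_n -> 'I_N.+1}) : {ffun 'I_n -> 'I_N.+1} :=
  [ffun a => inord (M + lam a)].
pose down (lam : {ffun 'I_n -> 'I_N.+1}) : {ffun 'I_n -> 'I_N.+1} :=
  [ffun a => inord (lam a - M)].
have lt_N (lam : {ffun 'I_n -> 'I_N.+1}) a : (lam a < N.+1)%N by [].
rewrite mulr_suml (reindex_onto up down) /=; last first.
  move=> lam /andP[_ /forallP lam_M]; apply/ffunP => a; apply: ord_inj.
  have lt_a := lt_N lam a; have down_a : down lam a = (lam a - M)%N :> nat.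
    by rewrite ffunE inordK //; lia.
  by rewrite ffunE inordK down_a subnKC.
have upE (lam : {ffun 'I_n -> 'I_N.+1}) :
    bounded_fun (N - M).+1 (fun a => lam a) -> forall a, up lam a = (M + lam a)%N :> nat.
  by move=> /forallP b a; rewrite ffunE inordK //; have := b a; lia.
have cond (lam : {ffun 'I_n -> 'I_N.+1}) :
  (mono_fun (fun a => up lam a) && [forall a, M <= up lam a]%N) && (down (up lam) == lam) =
  mono_fun (fun a => lam a) && bounded_fun (N - M).+1 (fun a => lam a).
  apply/andP/andP => [[/andP[/mono_funP m /forallP b] /eqP e]|[/mono_funP m b]].
    have eb a : (lam a + M = up lam a)%N.
      have ba : (M <= up lam a)%N := b a.
      by rewrite -{1}e ffunE inordK ?subnK //; have := lt_N (up lam) a; lia.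
    split; first by apply/mono_funP => a a' aa'; rewrite -(leq_add2r M) !eb; apply: m.
    by apply/forallP => a; have := eb a; have := lt_N (up lam) a; lia.
  split.
    apply/andP; split; first by apply/mono_funP => a a' aa'; rewrite !upE // leq_add2l m.
    by apply/forallP => a; rewrite upE // leq_addr.
  by apply/eqP/ffunP => a; apply: ord_inj; rewrite ffunE upE // addKn inordK.
apply: eq_big => // lam; rewrite cond => /andP[_ b].
rewrite -mulrA sp_det_prod; congr (t ^+ _ * _).
  by apply: eq_bigr => a _; rewrite upE.
by apply: eq_sp_prod => a; rewrite upE.
Qed.

Lemma parity_defect_even n (t : rat) (lam : 'I_n -> nat) M d :
  t ^+ parity_defect (M + d.*2) (fun a => M + lam a)%N = parity_weight t lam.
Proof.
rewrite /parity_defect expr_sum; apply: eq_bigr => a _.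
by rewrite !oddD odd_double addbF; case: (odd M); case: (odd (lam a)).
Qed.

(** When $N-M$ is odd, the parts of the wrong parity are those with even
    distance from [M], whereas [parity_weight] marks the odd ones; hence the inverse
    weight. *)
Lemma parity_defect_odd n (t : rat) (lam : 'I_n -> nat) M d : t != 0 ->
  t ^+ parity_defect (M + d.*2.+1) (fun a => M + lam a)%N = t ^+ n * parity_weight t^-1 lam.
Proof.
move=> t0; rewrite /parity_defect expr_sum /parity_weight -[n in t ^+ n]card_ord -prodr_const -big_split.
apply: eq_bigr => a _; rewrite !oddD /= odd_double.
by case: (odd M); case: (odd (lam a)); rewrite /= ?expr0 ?expr1 ?divff ?mulr1.
Qed.

Lemma weighted_count_even (t : rat) n M d : 0 < t ->
  (\sum_(f in trapezoidal_pps n (M + d.*2) M) t ^+ diagonal_parity_defect f) *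
    sp_prod (fun i : 'I_n => i.+1) ^+ 2 =
  \sum_(p < n.+1) t ^+ p * (sp_prod (fun i => d + lift p i)%N *
                            sp_prod (fun i : 'I_n => M + d + i.+1)%N).
Proof.
move=> t0; rewrite expr2 mulrA weighted_count_shift ?leq_addr //.
transitivity (sp_prod_sum t (M + d.*2) n M d.*2.+1 * sp_prod (fun i : 'I_n => i.+1)).
  congr (_ * _); rewrite addKn; apply: eq_bigr => lam _.
  by rewrite (parity_defect_even t (fun a => lam a)).
rewrite sp_prod_sum_even ?leq_addl // mulr_suml; apply: eq_bigr => p _.
by rewrite mulrA.
Qed.

Lemma weighted_count_odd (t : rat) n M d : 0 < t ->
  (\sum_(f in trapezoidal_pps n (M + d.*2.+1) M) t ^+ diagonal_parity_defect f) *
    sp_prod (fun i : 'I_n => i.+1) ^+ 2 =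
  \sum_(p < n.+1) t ^+ p * (sp_prod (fun i => M + d.+1 + lift p i)%N *
                            sp_prod (fun i : 'I_n => d + i.+1)%N).
Proof.
move=> t0; have tn0 : t != 0 by rewrite gt_eqF.
rewrite expr2 mulrA weighted_count_shift ?leq_addr //.
transitivity (t ^+ n * (sp_prod_sum t^-1 (M + d.*2.+1) n M d.*2.+2 * sp_prod (fun i : 'I_n => i.+1))).
  rewrite mulrA; congr (_ * _); rewrite addKn mulr_sumr; apply: eq_bigr => lam _.
  by rewrite (parity_defect_odd (fun a => lam a)) // -mulrA.
rewrite sp_prod_sum_odd ?invr_gt0 ?leq_addl // mulrCA !mulr_sumr; apply: eq_bigr => p _.
have -> : sp_prod (fun i => M + d + (lift p i).+1)%N = sp_prod (fun i => M + d.+1 + lift p i)%N.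
  by apply: eq_sp_prod => i; rewrite !addnS !addSn.
(* The defect is n minus the number of odd distances from M. *)
have tp : t ^+ n * t^-1 ^+ (n - p) = t ^+ p.
  apply: (mulIf (expf_neq0 (n - p) tn0)); rewrite exprVn divfK ?expf_neq0 //.
  by rewrite -exprD subnKC // -ltnS.
by rewrite -tp; ring.
Qed.

Lemma diagonal_parity_defect_le n N (f : filling n N) : (diagonal_parity_defect f <= n)%N.
Proof.
rewrite /diagonal_parity_defect (card_on_diagonal f (fun v => odd v != odd N)).
rewrite -[X in (_ <= X)%N]card_ord -sum1_card; apply: leq_sum => a _.
exact: leq_b1.
Qed.

Lemma count_by_parity (t : rat) n N M :
  \sum_(f in trapezoidal_pps n N M) t ^+ diagonal_parity_defect f =
  \sum_(p < n.+1) t ^+ p * #|trapezoidal_pps_parity n N M p|%:R.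
Proof.
rewrite (partition_big (fun f => inord (diagonal_parity_defect f) : 'I_n.+1) xpredT) //=.
apply: eq_bigr => p _; rewrite mulr_natr -sumr_const.
have e (f : filling n N) : (inord (diagonal_parity_defect f) == p) = (diagonal_parity_defect f == p).
  by rewrite -val_eqE /= inordK // ltnS diagonal_parity_defect_le.
apply: eq_big => [f|f /andP[_]]; first by rewrite !inE e.
by rewrite e => /eqP ->.
Qed.

(** The weight [t] serves as a formal variable: polynomials that agree at all
    positive rationals are equal. *)
Lemma coef_eq_of_pos n (a b : 'I_n -> rat) :
  (forall t, 0 < t -> \sum_(p < n) t ^+ p * a p = \sum_(p < n) t ^+ p * b p) -> a =1 b.
Proof.
case: n a b => [|n] a b h p; first by case: p.
pose P (c : 'I_n.+1 -> rat) := \poly_(i < n.+1) c (inord i).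
have PE c t : (P c).[t] = \sum_(p < n.+1) t ^+ p * c p.
  by rewrite horner_poly; apply: eq_bigr => i _; rewrite inord_val mulrC.
have e : P a = P b by apply: (@poly_eq_on_gt 0) => t t0; rewrite !PE h.
have := congr1 (fun q : {poly rat} => q`_p) e.
by rewrite !coef_poly ltn_ord inord_val.
Qed.

Lemma counts_even n M d (p : nat) : (p <= n)%N ->
  #|trapezoidal_pps_parity n (M + d.*2) M p|%:R =
  'C(n, p)%:R * binom_quotient (2 * d + n) p n.+1 *
      tri_prod n (fun i j => ((2 * d)%N%:R + i%:R + j%:R) * ((2 * (M + d))%N%:R + i%:R + j%:R)
                             / (i%:R + j%:R) ^+ 2).
Proof.
move=> pn; apply: count_from_products => //.
apply: etrans (@coef_eq_of_pos n.+1
  (fun q => #|trapezoidal_pps_parity n (M + d.*2) M q|%:R * sp_prod (fun i : 'I_n => i.+1) ^+ 2)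
  (fun q => sp_prod (fun i => d + lift q i)%N * sp_prod (fun i : 'I_n => M + d + i.+1)%N)
  _ (inord p)); first by rewrite inordK.
move=> t t0; rewrite -weighted_count_even // count_by_parity mulr_suml.
by apply: eq_bigr => q _; rewrite mulrA.
Qed.

Lemma counts_odd n M d (p : nat) : (p <= n)%N ->
  #|trapezoidal_pps_parity n (M + d.*2.+1) M p|%:R =
  'C(n, p)%:R * binom_quotient (2 * (M + d.+1) + n) p n.+1 *
      tri_prod n (fun i j => ((2 * (M + d.+1))%N%:R + i%:R + j%:R) * ((2 * d)%N%:R + i%:R + j%:R)
                             / (i%:R + j%:R) ^+ 2).
Proof.
move=> pn; apply: count_from_products => //.
apply: etrans (@coef_eq_of_pos n.+1
  (fun q => #|trapezoidal_pps_parity n (M + d.*2.+1) M q|%:R * sp_prod (fun i : 'I_n => i.+1) ^+ 2)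
  (fun q => sp_prod (fun i => M + d.+1 + lift q i)%N * sp_prod (fun i : 'I_n => d + i.+1)%N)
  _ (inord p)); first by rewrite inordK.
move=> t t0; rewrite -weighted_count_odd // count_by_parity mulr_suml.
by apply: eq_bigr => q _; rewrite mulrA.
Qed.

(** The count for a fixed parity defect depends on [p] only through the first
    two factors, which [sum_counts] sums. *)
Lemma total_from_counts n N M u v :
  (forall p, (p <= n)%N -> #|trapezoidal_pps_parity n N M p|%:R =
    'C(n, p)%:R * binom_quotient (2 * u + n) p n.+1 *
      tri_prod n (fun i j => ((2 * u)%N%:R + i%:R + j%:R) * ((2 * v)%N%:R + i%:R + j%:R)
                             / (i%:R + j%:R) ^+ 2) :> rat) ->
  #|trapezoidal_pps n N M|%:R =
  2 ^+ n * tri_prod n (fun i j => ((2 * v)%N%:R + i%:R + j%:R) * ((2 * u)%N%:R - 1 + i%:R + j%:R)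
                             / (i%:R + j%:R) ^+ 2) :> rat.
Proof.
move=> h; have := count_by_parity 1 n N M.
under eq_bigr do rewrite expr1n.
under [RHS]eq_bigr do rewrite expr1n mul1r.
rewrite sumr_const => ->.
pose B w := tri_prod n (fun i j => ((2 * w)%N%:R + i%:R + j%:R) / (i%:R + j%:R)).
transitivity ((\sum_(p < n.+1) 'C(n, p)%:R * binom_quotient (2 * u + n) p n.+1 * B u) * B v).
  rewrite mulr_suml; apply: eq_bigr => p _; rewrite h -1?ltnS // -[RHS]mulrA /B -tri_prodM.
  congr (_ * _); do 2!(apply: eq_bigr => ? _); by rewrite mulf_div expr2.
rewrite sum_counts -mulrA -tri_prodM; congr (_ * _).
by do 2!(apply: eq_bigr => ? _); rewrite mulf_div expr2 [X in X / _]mulrC.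
Qed.

Theorem theorem7 (n N M : nat) (hn : (1 <= n)%N) (hMN : (M <= N)%N) :
  (forall p : nat, (p <= n)%N ->
     (~~ odd (N + M) ->
        #|trapezoidal_pps_parity n N M p|%:R =
        'C(n, p)%:R * binom_quotient (N - M + n) p n.+1 *
        \prod_(1 <= i < n.+1) \prod_(i <= j < n.+1)
          ((N%:R + M%:R + i%:R + j%:R) * (N%:R - M%:R + i%:R + j%:R)
           / (i%:R + j%:R) ^+ 2) :> rat)
     /\
     (odd (N + M) ->
        #|trapezoidal_pps_parity n N M p|%:R =
        'C(n, p)%:R * binom_quotient (N + M + n + 1) p n.+1 *
        \prod_(1 <= i < n.+1) \prod_(i <= j < n.+1)
          ((N%:R + M%:R + 1 + i%:R + j%:R) * (N%:R - M%:R - 1 + i%:R + j%:R)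
           / (i%:R + j%:R) ^+ 2) :> rat))
  /\
  #|trapezoidal_pps n N M|%:R =
  2 ^+ n * \prod_(1 <= i < n.+1) \prod_(i <= j < n.+1)
    ((N%:R + M%:R + i%:R + j%:R) * (N%:R - M%:R - 1 + i%:R + j%:R)
     / (i%:R + j%:R) ^+ 2) :> rat.
Proof.
have dbl k : (2 * k)%N%:R = k%:R + k%:R :> rat by rewrite mul2n -addnn natrD.
have oddNM : odd (N + M) = odd (N - M) by rewrite oddD oddB.
rewrite oddNM; have := odd_double_half (N - M); case: (odd _); rewrite ?add1n ?add0n.
  set d := _./2 => eNM; have {}eNM : N = (M + d.*2.+1)%N by rewrite eNM subnKC.
  have NR : N%:R = M%:R + d%:R + d%:R + 1 :> rat.
    by rewrite eNM -addnn addnS -natr1 !natrD; ring.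
  have cnt := fun p => @counts_odd n M d p; rewrite -eNM in cnt.
  split.
    move=> p pn; split=> // _; rewrite cnt //; congr (_ * binom_quotient _ _ _ * _).
      by rewrite eNM; lia.
    do 2!(apply: eq_bigr => ? _); congr (_ * _ / _); rewrite !dbl ?natrD -?natr1 NR; ring.
  rewrite (total_from_counts cnt); congr (_ * _).
  do 2!(apply: eq_bigr => ? _); rewrite [X in X / _ = _]mulrC.
  congr (_ * _ / _); rewrite !dbl ?natrD -?natr1 NR; ring.
set d := _./2 => eNM; have {}eNM : N = (M + d.*2)%N by rewrite eNM subnKC.
have NR : N%:R = M%:R + d%:R + d%:R :> rat by rewrite eNM -addnn !natrD; ring.
have cnt := fun p => @counts_even n M d p; rewrite -eNM in cnt.
split.
  move=> p pn; split=> // _; rewrite cnt //; congr (_ * binom_quotient _ _ _ * _).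
    by rewrite eNM; lia.
  do 2!(apply: eq_bigr => ? _); rewrite [X in X / _ = _]mulrC.
  congr (_ * _ / _); rewrite !dbl ?natrD NR; ring.
rewrite (total_from_counts cnt); congr (_ * _).
do 2!(apply: eq_bigr => ? _); congr (_ * _ / _); rewrite !dbl ?natrD NR; ring.
Qed.
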